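(* Consider, for each sample size $n$, the Gaussian linear model $\mathbf{Y}=X\boldsymbol{\beta}+\boldsymbol{\epsilon}$ with fixed design $X\in\mathbb{R}^{n\times p}$, $\boldsymbol{\epsilon}\sim\mathcal{N}(\mathbf{0},\sigma^2 I_n)$, known $\sigma>0$, and active set $S=\{j:\beta_j\neq 0\}$ (where $p$, $X$, $\boldsymbol\beta$, $S$ may depend on $n$). Let $B\in\mathbb{N}$ be fixed and finite, and for each $n$ let $B$ splits of the $n$ observations into two disjoint groups of sizes $n_1$ and $n_2$ be given. Let $\tilde S^{(b)}$, with $\tilde s^{(b)}=|\tilde S^{(b)}|$, be the Lasso-selected set of split $b$, and let $P_j^{(b)}$, $b=1,\dots,B$, $j=1,\dots,p$, be the Bonferroni-adjusted carving p-values defined in the context, computed with the known $\sigma$. Assume that for every $b$: (i) (asymptotic screening) $\lim_{n\to\infty}\mathrm{P}[\tilde S^{(b)}\supseteq S]=1$; (ii) (sparsity) $\tilde s^{(b)}<n_1$, and $X_1^{(b)}$ restricted to the columns in $\tilde S^{(b)}$ has rank $\tilde s^{(b)}$. Let $\alpha,\gamma\in(0,1]$ and define $$Q_j(\gamma)=\min\Big\{1,\ q_\gamma\big(\{P_j^{(b)}/\gamma;\ b=1,\dots,B\}\big)\Big\},$$ where $q_\gamma$ is the empirical $\gamma$-quantile. Then $$\limsup_{n\to\infty}\ \mathrm{P}\Big[\min_{j\notin S}Q_j(\gamma)\le\alpha\Big]\le\alpha,$$ where the probability is with respect to the data sample $\mathbf Y$; the statement holds regardless of the $B$ sample splits.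
   Context: Empirical quantile: $q_\gamma(\{x_1,\dots,x_B\})=\inf\{x:\ \#\{b:x_b\le x\}\ge\gamma B\}$. Multicarving p-values. For a given split $b$, $(X_1,\mathbf{Y}_1)$ denotes the $n_1$ observations (rows) in the first group (selection data); the remaining $n_2$ observations are used for inference only. Write $X_{\tilde S}$ (resp. $X_{1,\tilde S}$) for $X$ (resp. $X_1$) restricted to the columns in $\tilde S$, and $X_{\tilde S}^+=(X_{\tilde S}^\top X_{\tilde S})^{-1}X_{\tilde S}^\top$; $(X_{\tilde S}^+)_j$ is its row corresponding to variable $j\in\tilde S$. Selection: with a predetermined $\lambda>0$, $\widehat{\boldsymbol\beta}=\arg\min_{\mathbf{b}\in\mathbb{R}^p}\tfrac12\|\mathbf{Y}_1-X_1\mathbf{b}\|_2^2+\lambda\|\mathbf{b}\|_1$ (assumed to be uniquely defined) and $\tilde S=\tilde S^{(b)}=\{j:\widehat\beta_j\ne0\}$. Let $\widehat{\boldsymbol\xi}=(\mathrm{sign}(\widehat\beta_j))_{j\in\tilde S}$. The event that the Lasso selects $\tilde S$ with signs $\widehat{\boldsymbol\xi}$ is described by linear inequalities in $\mathbf{Y}_1$, of which only the ''active'' ones are retained: $$A\mathbf{Y}\le\mathbf{b}\ :\iff\ -\mathrm{diag}(\widehat{\boldsymbol\xi})(X_{1,\tilde S}^\top X_{1,\tilde S})^{-1}X_{1,\tilde S}^\top\mathbf{Y}_1\le-\lambda\,\mathrm{diag}(\widehat{\boldsymbol\xi})(X_{1,\tilde S}^\top X_{1,\tilde S})^{-1}\widehat{\boldsymbol\xi}.$$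 Selected-model carving p-value: for an observation $\mathbf{y}$ of $\mathbf{Y}$ and $j\in\tilde S$ with $\widehat\beta_j>0$, $$p_j^{(b)}=\mathrm{P}\Big[(X_{\tilde S}^+)_j\mathbf{Y}\ge(X_{\tilde S}^+)_j\mathbf{y}\ \Big|\ \beta_j^{\tilde S}=0,\ (X_{\tilde S\setminus j})^\top\mathbf{Y}=(X_{\tilde S\setminus j})^\top\mathbf{y},\ A\mathbf{Y}\le\mathbf{b}\Big],$$ and with $\ge$ replaced by $\le$ inside the probability if $\widehat\beta_j<0$. Here $\tilde S$ and $\widehat{\boldsymbol\xi}$ (hence $A,\mathbf{b}$) are held fixed at their observed values and the probability is computed under the selected model $\mathbf{Y}\sim\mathcal{N}(X_{\tilde S}\boldsymbol\beta^{\tilde S},\sigma^2I_n)$ with $\beta^{\tilde S}_j=0$ (after this conditioning it does not depend on the remaining coordinates of $\boldsymbol\beta^{\tilde S}$). For $j\notin\tilde S^{(b)}$ set $p_j^{(b)}=1$. Bonferroni adjustment: $P_j^{(b)}=\min(p_j^{(b)}\,\tilde s^{(b)},1)$.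
   Formalization: When the Lasso selects nothing, the adjusted p-values are set to 1; the literal formula min(p_j·0, 1) = 0 would reject every variable and make the claim false (e.g. β = 0 with a very large λ). *)

(* Defs.v *)
From HB Require Import structures.
From mathcomp Require Import all_boot all_order all_algebra.
From mathcomp Require Import all_classical all_reals all_analysis.

Set Implicit Arguments.
Unset Strict Implicit.
Unset Printing Implicit Defensive.

Import Order.TTheory GRing.Theory Num.Theory.
Import numFieldNormedType.Exports.

Local Open Scope classical_set_scope.
Local Open Scope ring_scope.

(* The product sigma-algebra on matrices, generated by the entries; on 'cV[R]_n
   it is the Borel sigma-algebra of R^n. *)
Definition measure_matrix_display : measure_display -> measure_display.
Proof. exact. Qed.

Section measurable_matrix.
Context {d : measure_display} {T : measurableType d} (m n : nat).

Definition mx_cylinders : set (set 'M[T]_(m, n)) :=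
  [set E | exists i j, exists2 B : set T, measurable B &
     E = (fun M : 'M[T]_(m, n) => M i j) @^-1` B].

Let mx_set0 : <<s mx_cylinders >> set0.
Proof. exact: sigma_algebra0. Qed.

Let mx_setC A : <<s mx_cylinders >> A -> <<s mx_cylinders >> (~` A).
Proof. exact: sigma_algebraC. Qed.

Let mx_bigcup (F : (set 'M[T]_(m, n))^nat) :
  (forall i, <<s mx_cylinders >> (F i)) -> <<s mx_cylinders >> (\bigcup_i F i).
Proof. exact: sigma_algebra_bigcup. Qed.

HB.instance Definition _ := @isMeasurable.Build (measure_matrix_display d)
  'M[T]_(m, n) <<s mx_cylinders >> mx_set0 mx_setC mx_bigcup.

End measurable_matrix.

Section regression.
Context {R : realType}.

(* Y ~ N(mu, sigma^2 I_n): Y is measurable and its coordinates are independent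
   with laws N(mu_i, sigma^2); the second argument of normal_prob is the
   standard deviation. *)
Definition gaussian_vector (d : measure_display) (Omega : measurableType d)
    (P : probability Omega R) (n : nat) (Y : Omega -> 'cV[R]_n)
    (mu : 'cV[R]_n) (sigma : R) : Prop :=
  measurable_fun [set: Omega] Y /\
  forall A : 'I_n -> set R, (forall i, measurable (A i)) ->
    P [set w | forall i, A i (Y w i 0)] =
    (\prod_(i < n) normal_prob (mu i 0%R) sigma (A i))%E.

(* kap t is the conditional law given {T = t} and C (a regular version). *)
Definition cond_law (d d' : measure_display) (Omega : measurableType d)
    (V : measurableType d') (mu : probability Omega R) (T : Omega -> V)
    (C : set Omega) (kap : R.-pker V ~> Omega) : Prop :=
  forall (E : set Omega) (F : set V), measurable E -> measurable F ->
    mu (E `&` (T @^-1` F `&` C)) =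
    (\int[mu]_(w in T @^-1` F `&` C) kap (T w) E)%E.

Definition rows_in (n p : nat) (I : {set 'I_n}) (X : 'M[R]_(n, p)) :
  'M[R]_(#|I|, p) := rowsub (fun k : 'I_#|I| => enum_val k) X.

Definition cols_in (n p : nat) (S : {set 'I_p}) (X : 'M[R]_(n, p)) :
  'M[R]_(n, #|S|) := colsub (fun k : 'I_#|S| => enum_val k) X.

Definition lsq_pinv (n s : nat) (X : 'M[R]_(n, s)) : 'M[R]_(s, n) :=
  invmx (X^T *m X) *m X^T.

Definition lasso_objective (n p : nat) (X : 'M[R]_(n, p)) (y : 'cV[R]_n)
    (lam : R) (b : 'cV[R]_p) : R :=
  2^-1 * (\sum_(i < n) (y - X *m b) i 0 ^+ 2) + lam * \sum_(j < p) `|b j 0|.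

Definition is_lasso (n p : nat) (X : 'M[R]_(n, p)) (y : 'cV[R]_n) (lam : R)
    (b : 'cV[R]_p) : Prop :=
  forall v, v != b -> lasso_objective X y lam b < lasso_objective X y lam v.

Definition active_set (p : nat) (b : 'cV[R]_p) : {set 'I_p} :=
  [set j | b j 0 != 0]%SET.

Definition sign_vector (p : nat) (b : 'cV[R]_p) : 'cV[R]_#|active_set b| :=
  \col_k Num.sg (b (enum_val k) 0).

(* The event A Y <= b; I is the selection half of the split. *)
Definition active_constraints (n p : nat) (X : 'M[R]_(n, p)) (I : {set 'I_n})
    (lam : R) (S : {set 'I_p}) (xi : 'cV[R]_#|S|) : set 'cV[R]_n :=
  let X1S := cols_in S (rows_in I X) in
  [set y | forall k : 'I_#|S|,
    (- diag_mx xi^T *m invmx (X1S^T *m X1S) *m X1S^T *m rows_in I y) k 0 <=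
    (- lam *: (diag_mx xi^T *m invmx (X1S^T *m X1S) *m xi)) k 0].

(* p is the carving p-value of j in S as a function of the observation y, with
   S and the signs xi held fixed.  Since {X_{S\j}^T Y = X_{S\j}^T y} is in
   general a null event, the conditional probability is read off a regular
   conditional law kap; a single kap serves all the laws of the selected model
   with zero j-th coefficient.  Any version of kap may be used. *)
Definition is_carving_pvalue (n p : nat) (X : 'M[R]_(n, p)) (sigma : R)
    (I : {set 'I_n}) (lam : R) (S : {set 'I_p}) (xi : 'cV[R]_#|S|)
    (j : 'I_p) (jS : j \in S) (pval : 'cV[R]_n -> R) : Prop :=
  let k := enum_rank_in jS j in
  let T := fun y : 'cV[R]_n => (cols_in (S :\ j)%SET X)^T *m y in
  let eta := fun y : 'cV[R]_n => (lsq_pinv (cols_in S X) *m y) k 0 in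
  exists kap : R.-pker 'cV[R]_#|(S :\ j)%SET| ~> 'cV[R]_n,
    (forall (mu : probability 'cV[R]_n R) (bS : 'cV[R]_#|S|),
       gaussian_vector mu id (cols_in S X *m bS) sigma -> bS k 0 = 0 ->
       cond_law mu T (active_constraints X I lam xi) kap) /\
    forall y, (pval y)%:E =
      kap (T y) (if 0 < xi k 0 then [set y' | eta y' >= eta y]
                 else [set y' | eta y' <= eta y]).

(* Variables outside S get 1; for nonempty S this is min(1 * #|S|, 1), and it
   makes explicit that nothing is rejected when S is empty. *)
Definition bonferroni (p : nat) (S : {set 'I_p}) (pval : 'I_p -> R)
    (j : 'I_p) : R :=
  if j \in S then Num.min (pval j * #|S|%:R) 1 else 1.

Definition emp_quantile (B : nat) (gamma : R) (x : 'I_B -> R) : R :=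
  inf [set t : R | #|[pred b | x b <= t]|%:R >= gamma * B%:R].

Definition aggregate (B : nat) (gamma : R) (P : 'I_B -> R) : R :=
  Num.min 1 (emp_quantile gamma (fun b => P b / gamma)).

End regression.

(* Main.v *)
Require Import Defs.
From HB Require Import structures.
From mathcomp Require Import all_boot all_order all_algebra.
From mathcomp Require Import all_classical all_reals all_analysis.
From mathcomp Require Import measurable_realfun.
From mathcomp Require Import ring lra.

Set Implicit Arguments.
Unset Strict Implicit.
Unset Printing Implicit Defensive.

Import Order.TTheory GRing.Theory Num.Theory.
Import numFieldNormedType.Exports.

Local Open Scope classical_set_scope.
Local Open Scope ring_scope.

(** Fix the sample size and let [mu] be the law of Y. For one split, the sample space is partitioned
    by the sign vector of the Lasso estimate. By the KKT conditions and the uniqueness of the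
    minimiser, the cell with selected set S is, up to strictness of inequalities, the intersection
    of the active constraints A Y <= b with the inactive ones, which bound the correlations of the
    residual ([selection_eventE]).

    The p-value conditions on the active constraints only, so the crux is that the inactive ones
    cause no bias. Let Q be [lasso_proj], the orthogonal projection onto the vectors supported on
    the selection rows and orthogonal to the columns of X_{1,S}. The inactive constraints depend on
    y through Q y alone, whereas the active constraints, the test statistic and the conditioning
    variable depend on y - Q y alone. If S contains the true active set, Q kills the mean X beta, so
    both parts are independent ([gaussian_mean_indep]) and the inactive constraints factor out.
    Given the active constraints, the p-value is the tail probability of its own statistic under a
    regular conditional law, hence superuniform fibre by fibre ([tail_superuniform],
    [cond_law_superuniform]). This gives [carving_superuniform]: within a cell, p_j <= u has mass at
    most u times that of the cell.

    With the Bonferroni factor, summing v/|S| over j in S and then over the cells bounds by v < 1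
    the expected number of false rejections at level v under screening ([false_rejection_sum]). For
    alpha < 1, Q_j <= alpha means that at least gamma B splits have P_j <= gamma alpha. Markov's
    inequality then bounds the error by alpha plus the sum over the splits of the probabilities that
    screening fails, whatever the dependence between splits ([familywise_error_le]); that sum tends
    to 0.

    The Gaussian law is given only by its values on boxes. Independence of orthogonal projections is
    derived from the Cameron-Martin formula ([gaussian_shift]) by a rotation of two independent
    copies ([gaussian_rotation]). *)

Section matrix_measurability.
Context {d : measure_display} {T : measurableType d}.

(** * Measurability of matrix-valued maps *)

Lemma measurable_mx_entry (m n : nat) (i : 'I_m) (j : 'I_n) :
  measurable_fun [set: 'M[T]_(m, n)] (fun M : 'M[T]_(m, n) => M i j).
Proof.
by move=> _ A mA; rewrite setTI; apply: sub_sigma_algebra; exists i, j, A.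
Qed.

Lemma measurable_mxP (d' : measure_display) (U : measurableType d') (m n : nat)
    (f : U -> 'M[T]_(m, n)) :
  (forall i j, measurable_fun setT (fun u => f u i j)) -> measurable_fun setT f.
Proof.
move=> mf; apply: (measurability (@mx_cylinders _ T m n)) => //.
by move=> _ [_ [i [j [A mA ->]]] <-]; apply: mf.
Qed.

Definition rectangle (n : nat) (A : 'I_n -> set T) : set 'cV[T]_n :=
  [set y | forall i, A i (y i 0)].

Lemma measurable_rectangle (n : nat) (A : 'I_n -> set T) :
  (forall i, measurable (A i)) -> measurable (rectangle A).
Proof.
move=> mA; have -> : rectangle A =
    \bigcap_(i in [set: 'I_n]) ((fun y : 'cV[T]_n => y i 0) @^-1` A i).
  by apply/seteqP; split => y /= Ay i => [_|]; apply: Ay.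
apply: fin_bigcap_measurable => [|i _]; first exact: finite_finset.
by rewrite -[X in measurable X]setTI; exact: measurable_mx_entry.
Qed.

(** Boxes form a pi-system generating the product sigma-algebra, so the product formula in
    [gaussian_vector] determines the law. *)
Lemma rectangle_measure_unique (R : realType) (n : nat)
    (m1 m2 : {measure set 'cV[T]_n -> \bar R}) :
  (m1 setT < +oo)%E ->
  (forall A : 'I_n -> set T, (forall i, measurable (A i)) ->
     m1 (rectangle A) = m2 (rectangle A)) ->
  forall E, measurable E -> m1 E = m2 E.
Proof.
move=> m1oo m12 E mE.
pose G := [set rectangle A | A in [set A : 'I_n -> set T | forall i, measurable (A i)]].
have GT : G setT by exists (fun=> setT) => //; apply/seteqP; split.
apply: (measure_unique G (fun=> setT)) => //.
- rewrite eqEsubset; split.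
    apply: smallest_sub; first exact: smallest_sigma_algebra.
    move=> _ [i [j [A mA ->]]]; apply: sub_sigma_algebra.
    exists (fun k => if k == i then A else setT); first by move=> k; case: ifP.
    rewrite (ord1 j); apply/seteqP; split => y /=; first by move=> /(_ i); rewrite eqxx.
    by move=> Ay k; case: eqP => [->|].
  apply: smallest_sub; first exact: sigma_algebra_measurable.
  by move=> _ [A mA <-]; exact: measurable_rectangle.
- move=> _ _ [A mA <-] [A' mA' <-]; exists (fun i => A i `&` A' i).
    by move=> i; exact: measurableI.
  by apply/seteqP; split => [y H|y [H H'] i]; [by split => i; have [] := H i|split; [exact: H|exact: H']].
- by rewrite bigcup_const.
- by move=> _ [A mA <-]; exact: m12.
Qed.

End matrix_measurability.

Section real_matrix_measurability.
Context {R : realType} {d : measure_display} {U : measurableType d}.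

Lemma measurable_mulmx (m n q : nat) (A : 'M[R]_(m, n)) (f : U -> 'M[R]_(n, q)) :
  measurable_fun setT f -> measurable_fun setT (fun u => A *m f u).
Proof.
move=> mf; apply: measurable_mxP => i j.
under eq_fun do rewrite mxE.
apply: measurable_sum => k; apply: measurable_funM => //.
exact: measurableT_comp (measurable_mx_entry k j) mf.
Qed.

Lemma measurable_addmx (m n : nat) (f g : U -> 'M[R]_(m, n)) :
  measurable_fun setT f -> measurable_fun setT g ->
  measurable_fun setT (fun u => f u + g u).
Proof.
move=> mf mg; apply: measurable_mxP => i j.
under eq_fun do rewrite mxE.
apply: measurable_funD; first exact: measurableT_comp (measurable_mx_entry i j) mf.
exact: measurableT_comp (measurable_mx_entry i j) mg.
Qed.

Lemma measurable_submx (m n : nat) (f g : U -> 'M[R]_(m, n)) :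
  measurable_fun setT f -> measurable_fun setT g ->
  measurable_fun setT (fun u => f u - g u).
Proof.
move=> mf mg; under eq_fun do rewrite -[g _]mul1mx -mulNmx.
by apply: measurable_addmx => //; exact: measurable_mulmx.
Qed.

End real_matrix_measurability.

(** * Measures with a density *)

Section density.
Context {d : measure_display} {T : measurableType d} {R : realType}.
Variables (m : {measure set T -> \bar R}) (g : T -> R).
Hypotheses (mg : measurable_fun setT g) (g0 : forall x, 0 <= g x).
Local Open Scope ereal_scope.

Let mgE : measurable_fun setT (EFin \o g). Proof. exact/measurable_EFinP. Qed.

(** The two proofs are arguments so that the measure structure declared below can be inferred from
    the term. *)
Definition mdensity (_ : measurable_fun setT g) (_ : forall x, (0 <= g x)%R)
  (A : set T) := \int[m]_(x in A) (g x)%:E.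

Let mdensity0 : mdensity mg g0 set0 = 0.
Proof. exact: integral_set0. Qed.

Let mdensity_ge0 A : 0 <= mdensity mg g0 A.
Proof. by apply: integral_ge0 => x _; rewrite lee_fin. Qed.

Let mdensity_sigma_additive : semi_sigma_additive (mdensity mg g0).
Proof.
move=> A mA tA mUA; rewrite /mdensity ge0_integral_bigcup//.
- by apply: is_cvg_ereal_nneg_natsum_cond => n _ _; exact: mdensity_ge0.
- exact: measurable_funTS.
- by move=> x _; rewrite lee_fin.
Qed.

HB.instance Definition _ := isMeasure.Build _ _ _
  (mdensity mg g0) mdensity0 mdensity_ge0 mdensity_sigma_additive.

Import HBNNSimple.

(** True for simple functions by linearity, then in general by monotone convergence. *)
Lemma ge0_integral_density (nu : {measure set T -> \bar R}) (f : T -> \bar R) :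
  (forall A, measurable A -> nu A = \int[m]_(x in A) (g x)%:E) ->
  measurable_fun setT f -> (forall x, 0 <= f x) ->
  \int[nu]_x f x = \int[m]_x (f x * (g x)%:E).
Proof.
move=> nuE mf f0.
have simple (h : {nnsfun T >-> R}) :
    \int[nu]_x (h x)%:E = \int[m]_x ((h x)%:E * (g x)%:E).
  have mind r : measurable_fun setT (\1_(h @^-1` [set r]) : T -> R).
    exact/measurable_indicP.
  have r0 r : range h r -> (0 <= r)%R by move=> [x _ <-].
  have hE x : (h x)%:E = \sum_(r \in range h) (r * \1_(h @^-1` [set r]) x)%:E.
    by rewrite fsumEFin// fimfunE.
  rewrite integralT_nnsfun sintegralE.
  under [RHS]eq_integral => x _.
    rewrite hE ge0_mule_fsuml; last by move=> r; exact: nnfun_muleindic_ge0.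
    over.
  rewrite ge0_integral_fsum//; last 2 first.
  - move=> r; apply: emeasurable_funM => //.
    by apply/measurable_EFinP; exact: measurable_funM.
  - by move=> r x _; apply: mule_ge0; [rewrite EFinM nnfun_muleindic_ge0|rewrite lee_fin].
  apply: eq_fsbigr => r /[!inE] rh.
  under eq_integral do rewrite EFinM -muleA.
  rewrite ge0_integralZl//; last 3 first.
  - by apply: emeasurable_funM => //; exact/measurable_EFinP.
  - by move=> x _; rewrite mule_ge0 ?lee_fin.
  - by rewrite lee_fin r0.
  rewrite nuE//; congr (_ * _); rewrite integral_mkcond; apply: eq_integral => x _.
  by rewrite epatch_indic muleC.
pose h := nnsfun_approx measurableT mf.
have hf x : EFin \o h^~ x @ \oo --> f x by exact: cvg_nnsfun_approx.
transitivity (limn (fun n => \int[nu]_x (h n x)%:E)).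
  rewrite -monotone_convergence//.
  - by apply: eq_integral => x _; apply/esym/cvg_lim => //; exact: hf.
  - by move=> n; exact/measurable_EFinP.
  - by move=> n x _; rewrite lee_fin.
  - by move=> x _ a b ab; rewrite lee_fin; exact/lefP/nd_nnsfun_approx.
under eq_fun do rewrite simple.
rewrite -monotone_convergence//.
- apply: eq_integral => x _; apply/cvg_lim => //.
  by apply: cvgeZr => //; exact: hf.
- by move=> n; apply: emeasurable_funM => //; exact/measurable_EFinP.
- by move=> n x _; rewrite mule_ge0 ?lee_fin.
- move=> x _ a b ab; rewrite lee_wpmul2r ?lee_fin//.
  exact/lefP/nd_nnsfun_approx.
Qed.

End density.

Lemma ge0_integral_mrestr (d : measure_display) (T : measurableType d)
    (R : realType) (m : {measure set T -> \bar R}) (D : set T)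
    (mD : measurable D) (f : T -> \bar R) :
  measurable_fun setT f -> (forall x, 0 <= f x)%E ->
  (\int[mrestr m mD]_x f x = \int[m]_(x in D) f x)%E.
Proof.
move=> mf f0.
rewrite (@ge0_integral_density _ _ _ m (\1_D)) => [|||E mE||]//; last first.
  by rewrite integral_indic// setIC.
by rewrite [RHS]integral_mkcond epatch_indic.
Qed.

(** * Translating a normal law on the line *)

Section normal_shift.
Context {R : realType}.

Let measurable_addr (t : R) : measurable_fun [set: R] (fun x : R => x + t).
Proof. exact: measurable_funD. Qed.

Lemma lebesgue_measure_shift (t : R) (A : set R) : measurable A ->
  lebesgue_measure ((fun x : R => x + t) @^-1` A) = lebesgue_measure A.
Proof.
move=> mA; have mt := measurable_addr t.
apply/esym.
rewrite (@lebesgue_measure_unique R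
  (pushforward lebesgue_measure (fun x : measurableTypeR R => (x + t : measurableTypeR R))))//.
move=> _ [[a b] _ <-]; rewrite /=.
transitivity (lebesgue_measure (`](a - t), (b - t)]%classic : set R)).
  rewrite !lebesgue_measure_itv/= !lte_fin ltrD2r; case: ifP => // _.
  by rewrite -!EFinD; congr EFin; ring.
congr (lebesgue_measure _); apply/seteqP.
by split => x /=; rewrite !in_itv/= ltrBlDr lerBrDr.
Qed.

Lemma normal_prob_shift (m s t : R) (A : set R) : s != 0 -> measurable A ->
  normal_prob m s ((fun x : R => x + t) @^-1` A) = normal_prob (m + t) s A.
Proof.
move=> s0 mA; pose f (x : measurableTypeR R) : measurableTypeR R := x + t.
have mf : measurable_fun setT f by exact: measurable_addr.
have mpdf : measurable_fun (A : set (measurableTypeR R))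
    (fun x => (normal_pdf (m + t) s x)%:E).
  by apply/measurable_funTS/measurable_EFinP; exact: measurable_normal_pdf.
transitivity (\int[pushforward lebesgue_measure f]_(x in A)
   (normal_pdf (m + t)%R s x)%:E)%E.
  rewrite ge0_integral_pushforward; [|exact: mf|exact: mA|exact: mpdf|]; last first.
    by move=> x _; rewrite lee_fin normal_pdf_ge0.
  apply: eq_integral => x _ /=; congr EFin.
  rewrite !normal_pdfE// /normal_fun /f.
  by have -> : x + t - (m + t) = x - m by ring.
rewrite /normal_prob; apply: eq_measure_integral => E mE _.
exact: lebesgue_measure_shift.
Qed.

(** The density of N(t, s^2) with respect to N(0, s^2). *)
Definition tilt (s t x : R) : R := expR ((t * x - t ^+ 2 / 2) / s ^+ 2).

Lemma measurable_tilt (s t : R) : measurable_fun setT (tilt s t).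
Proof.
apply: measurableT_comp => //; apply: measurable_funM => //.
by apply: measurable_funB => //; exact: measurable_funM.
Qed.

Lemma normal_prob_tilt (s t : R) (A : set R) : s != 0 -> measurable A ->
  normal_prob t s A = (\int[normal_prob 0 s]_(x in A) (tilt s t x)%:E)%E.
Proof.
move=> s0 mA; rewrite [RHS]integral_mkcond.
rewrite (@ge0_integral_density _ _ _ lebesgue_measure (normal_pdf 0 s))//.
- rewrite /normal_prob [LHS]integral_mkcond; apply: eq_integral => x _.
  rewrite !patchE; case: ifP => _; last by rewrite mul0e.
  rewrite -EFinM; congr EFin; rewrite !normal_pdfE// mulrCA -expRD.
  by rewrite /normal_fun; congr (_ * expR _); field.
- exact: measurable_normal_pdf.
- exact: normal_pdf_ge0.
- apply/(measurable_restrictT _ mA)/measurable_funTS/measurable_EFinP.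
  exact: measurable_tilt.
- by move=> x; rewrite patchE; case: ifP => // _; rewrite lee_fin expR_ge0.
Qed.

End normal_shift.

(** * The Cameron-Martin formula for N(0, s^2 I) *)

Section gaussian_shift.
Context {R : realType}.
Variables (n : nat) (s : R) (s_neq0 : s != 0).

Definition dotp (x y : 'cV[R]_n) : R := (x^T *m y) 0 0.

Lemma dotpE x y : dotp x y = \sum_i x i 0 * y i 0.
Proof. by rewrite /dotp mxE; apply: eq_bigr => i _; rewrite mxE. Qed.

Lemma dotpC x y : dotp x y = dotp y x.
Proof. by rewrite !dotpE; apply: eq_bigr => i _; rewrite mulrC. Qed.

Lemma dotpDl x y z : dotp (x + y) z = dotp x z + dotp y z.
Proof. by rewrite /dotp raddfD mulmxDl mxE. Qed.

Lemma dotpDr x y z : dotp x (y + z) = dotp x y + dotp x z.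
Proof. by rewrite dotpC dotpDl !(dotpC x). Qed.

Lemma dotpNl x y : dotp (- x) y = - dotp x y.
Proof. by rewrite /dotp linearN mulNmx mxE. Qed.

Lemma dotpNr x y : dotp x (- y) = - dotp x y.
Proof. by rewrite dotpC dotpNl dotpC. Qed.

Lemma dotp_mulmxl (A : 'M[R]_n) x y : dotp (A *m x) y = dotp x (A^T *m y).
Proof. by rewrite /dotp trmx_mul mulmxA. Qed.

(* The density of N(h, s^2 I) with respect to N(0, s^2 I). *)
Definition tilt_mx (h x : 'cV[R]_n) : R :=
  expR ((dotp h x - dotp h h / 2) / s ^+ 2).

Lemma measurable_dotp (d : measure_display) (U : measurableType d)
    (f g : U -> 'cV[R]_n) :
  measurable_fun setT f -> measurable_fun setT g ->
  measurable_fun setT (fun u => dotp (f u) (g u)).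
Proof.
move=> mf mg; under eq_fun do rewrite dotpE.
apply: measurable_sum => i; apply: measurable_funM.
  exact: measurableT_comp (measurable_mx_entry i 0) mf.
exact: measurableT_comp (measurable_mx_entry i 0) mg.
Qed.

Lemma measurable_tilt_mx (d : measure_display) (U : measurableType d)
    (f g : U -> 'cV[R]_n) :
  measurable_fun setT f -> measurable_fun setT g ->
  measurable_fun setT (fun u => tilt_mx (f u) (g u)).
Proof.
move=> mf mg; apply: measurableT_comp => //; apply: measurable_funM => //.
apply: measurable_funB; first exact: measurable_dotp.
by apply: measurable_funM => //; exact: measurable_dotp.
Qed.

Variable mu : probability 'cV[R]_n R.
Hypothesis mu_rect : forall A : 'I_n -> set R, (forall i, measurable (A i)) ->
  mu (rectangle A) = (\prod_(i < n) normal_prob 0 s (A i))%E.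

Let rect_split (A : 'I_n -> set R) i : rectangle A =
  (fun y : 'cV[R]_n => y i 0) @^-1` A i `&`
  rectangle (fun k => if k == i then setT else A k).
Proof.
apply/seteqP; split => y /=.
  by move=> Ay; split=> [|k]; [exact: Ay|case: ifP => // _; exact: Ay].
by move=> [Ai Ay] k; have := Ay k; case: eqP => [->|].
Qed.

Let mu_slice (A : 'I_n -> set R) i (E : set R) :
  (forall i, measurable (A i)) -> measurable E ->
  let D := rectangle (fun k => if k == i then setT else A k) in
  mu ((fun y : 'cV[R]_n => y i 0) @^-1` E `&` D) = (normal_prob 0 s E * mu D)%E.
Proof.
move=> mA mE D.
have mD k : measurable (if k == i then [set: R] else A k) by case: ifP.
have -> : (fun y : 'cV[R]_n => y i 0) @^-1` E `&` D =
    rectangle (fun k => if k == i then E else A k).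
  rewrite [RHS](rect_split _ i) eqxx; congr (_ `&` rectangle _).
  by apply/funext => k; case: ifP => // ->.
rewrite !mu_rect => [||k]//; last by case: ifP.
rewrite (bigD1 i)//= eqxx [in RHS](bigD1 i)//= eqxx probability_setT mul1e.
by congr (_ * _)%E; apply: eq_bigr => k /negbTE ->.
Qed.

(** Coordinate i is independent of the box [D] in the other coordinates: pushing [mu] restricted to
    [D] forward along coordinate i gives a multiple of N(0, s^2), under which the tilt integrates to
    N(t, s^2). *)
Let slice_tilt (A : 'I_n -> set R) i (t : R) : (forall i, measurable (A i)) ->
  let D := rectangle (fun k => if k == i then setT else A k) in
  (\int[mu]_(y in rectangle A) (tilt s t (y i 0))%:E)%E =
  (normal_prob t s (A i) * mu D)%E.
Proof.
move=> mA D.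
have mD : measurable D by apply: measurable_rectangle => k; case: ifP.
pose e (y : 'cV[R]_n) : measurableTypeR R := y i 0.
have me : measurable_fun setT e by exact: measurable_mx_entry.
pose c : {nonneg R} := NngNum (fine_ge0 (measure_ge0 mu D)).
have cE : c%:num%:E = mu D by rewrite /= fineK// fin_num_measure.
have mf : measurable_fun [set: measurableTypeR R]
    ((fun z => (tilt s t z)%:E) \_ (A i)).
  apply/(measurable_restrictT _ (mA i))/measurable_funTS/measurable_EFinP.
  exact: measurable_tilt.
have f0 z : (0 <= ((fun z => (tilt s t z)%:E) \_ (A i)) z)%E.
  by rewrite patchE; case: ifP => // _; rewrite lee_fin expR_ge0.
rewrite (rect_split A i) setIC -/D integral_mkcondr.
rewrite -(ge0_integral_mrestr mu mD); first last.
- by move=> y; rewrite patchE; case: ifP => // _; rewrite lee_fin expR_ge0.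
- exact: measurableT_comp mf me.
transitivity (\int[pushforward (mrestr mu mD) e]_y (((fun z => (tilt s t z)%:E) \_ (A i)) y))%E.
  by rewrite (ge0_integral_pushforward me)// => y _.
rewrite normal_prob_tilt// muleC -cE [in RHS]integral_mkcond.
rewrite -ge0_integral_mscale//.
apply: eq_measure_integral => E mE _.
by rewrite /= /mscale/= -[LHS]/(mu (e @^-1` E `&` D)) mu_slice// -cE muleC.
Qed.

Let rect_unit_shift (A : 'I_n -> set R) i (t : R) : (forall i, measurable (A i)) ->
  mu ((fun y => y + t *: delta_mx i 0) @^-1` rectangle A) =
  (\int[mu]_(y in rectangle A) (tilt s t (y i 0))%:E)%E.
Proof.
move=> mA; rewrite slice_tilt// -[t in normal_prob t]add0r -normal_prob_shift//.
rewrite -mu_slice//; last first.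
  by rewrite -[X in measurable X]setTI; apply: measurable_funD.
congr (mu _); rewrite (rect_split A i) preimage_setI.
congr (_ `&` _); apply/seteqP; split => y /=; rewrite ?mxE ?eqxx ?mulr1//.
  by move=> + k => /(_ k); rewrite !mxE; case: eqP => // _; rewrite mulr0 addr0.
by move=> + k => /(_ k); rewrite !mxE; case: eqP => // _; rewrite mulr0 addr0.
Qed.

(** The translated law and the tilted law agree on boxes, hence on all measurable sets, and
    integrals follow by [ge0_integral_density]. *)
Let unit_shift i t (f : 'cV[R]_n -> R) :
  measurable_fun setT f -> (forall x, 0 <= f x) ->
  (\int[mu]_y (f (y + t *: delta_mx i 0))%:E =
   \int[mu]_y (f y * tilt s t (y i 0))%:E)%E.
Proof.
move=> mf f0.
have mt : measurable_fun setT (fun y : 'cV[R]_n => tilt s t (y i 0)).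
  exact: measurableT_comp (measurable_tilt s t) (measurable_mx_entry i 0).
have t0 (y : 'cV[R]_n) : 0 <= tilt s t (y i 0) by exact: expR_ge0.
have mS : measurable_fun setT (fun y : 'cV[R]_n => y + t *: delta_mx i 0).
  by apply: measurable_addmx => //; exact: measurable_cst.
have mfE : measurable_fun setT (EFin \o f) by exact/measurable_EFinP.
transitivity (\int[pushforward mu (fun y => (y + t *: delta_mx i 0)%R)]_y (f y)%:E)%E.
  by rewrite (ge0_integral_pushforward mS)// => y _; rewrite lee_fin.
under [RHS]eq_integral do rewrite EFinM.
apply: (ge0_integral_density mt) => // E mE.
apply: (rectangle_measure_unique (m2 := mdensity mu mt t0)) mE.
  by rewrite -[X in (X < _)%E]/(mu (_ @^-1` setT)) preimage_setT probability_setT ltry.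
by move=> A mA; exact: rect_unit_shift.
Qed.

(** A predicate on h, so that stability under addition can be iterated over coordinates with
    [big_ind]. *)
Definition shift_law h := forall f : 'cV[R]_n -> R,
  measurable_fun setT f -> (forall x, 0 <= f x) ->
  (\int[mu]_y (f (y + h))%:E = \int[mu]_y (f y * tilt_mx h y)%:E)%E.

(* Cameron-Martin: it is enough to shift one coordinate at a time, since the
   tilts compose. *)
Lemma gaussian_shift h : shift_law h.
Proof.
have law0 : shift_law 0.
  move=> f mf f0; apply: eq_integral => y _.
  by rewrite addr0 /tilt_mx !dotpE !big1 => [|i _|i _]; rewrite ?mxE ?mul0r// subr0 mul0r expR0 mulr1.
have lawD h1 h2 : shift_law h1 -> shift_law h2 -> shift_law (h1 + h2).
  move=> law1 law2 f mf f0.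
  have mS h' : measurable_fun setT (fun y : 'cV[R]_n => y + h').
    by apply: measurable_addmx => //; exact: measurable_cst.
  transitivity (\int[mu]_y (f (y + h1) * tilt_mx h2 y)%:E)%E.
    under eq_integral do rewrite [h1 + h2]addrC addrA.
    exact: (law2 (fun y => f (y + h1)) (measurableT_comp mf (mS h1))).
  transitivity (\int[mu]_y (f (y + h1) * tilt_mx h2 (y + h1 - h1))%:E)%E.
    by apply: eq_integral => y _; rewrite addrK.
  rewrite (law1 (fun y => f y * tilt_mx h2 (y - h1))); last 2 first.
  - apply: measurable_funM => //; apply: (measurable_tilt_mx (measurable_cst h2) (mS (- h1))).
  - by move=> y; rewrite mulr_ge0 ?expR_ge0.
  apply: eq_integral => y _; congr EFin; rewrite -mulrA -expRD; congr (_ * expR _).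
  rewrite -mulrDl !dotpDl !dotpDr !dotpNr (dotpC h1 h2); congr (_ / _).
  by lra.
have lawU i t : shift_law (t *: delta_mx i 0).
  move=> f mf f0; rewrite (unit_shift _ _ mf f0); apply: eq_integral => y _.
  have dE z : dotp (t *: delta_mx i 0) z = t * z i 0.
    rewrite dotpE (bigD1 i)//= !mxE !eqxx mulr1 big1 ?addr0// => k /negbTE ki.
    by rewrite !mxE ki mulr0 mul0r.
  by rewrite /tilt_mx !dE !mxE !eqxx mulr1 expr2.
have -> : h = \sum_i h i 0 *: delta_mx i 0.
  by rewrite {1}[h]matrix_sum_delta; apply: eq_bigr => i _; rewrite big_ord1.
by apply: (big_ind shift_law law0 lawD) => i _; exact: lawU.
Qed.

End gaussian_shift.

(** * Rotation of two independent copies, and independence of orthogonal projections *)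

Section gaussian_rotation.
Context {R : realType}.
Variables (n : nat) (s : R) (mu : probability 'cV[R]_n R).
Hypothesis s_neq0 : s != 0.
Hypothesis mu_rect : forall A : 'I_n -> set R, (forall i, measurable (A i)) ->
  mu (rectangle A) = (\prod_(i < n) normal_prob 0 s (A i))%E.
Variable Q : 'M[R]_n.
Hypotheses (Q_sym : Q^T = Q) (Q_idem : Q *m Q = Q).

Let QQ (x : 'cV[R]_n) : Q *m (Q *m x) = Q *m x. Proof. by rewrite mulmxA Q_idem. Qed.

Let dotpQl (x y : 'cV[R]_n) : dotp x (Q *m y) = dotp (Q *m x) y.
Proof. by rewrite dotp_mulmxl Q_sym. Qed.

Let RnRn := [the measurableType _ of ('cV[R]_n * 'cV[R]_n)%type].

Let mQ (d : measure_display) (U : measurableType d) (f : U -> 'cV[R]_n) :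
  measurable_fun setT f -> measurable_fun setT (fun u => Q *m f u).
Proof. exact: measurable_mulmx. Qed.

Let mB (d : measure_display) (U : measurableType d) (f g : U -> 'cV[R]_n) :
  measurable_fun setT f -> measurable_fun setT g ->
  measurable_fun setT (fun u => f u - g u).
Proof. exact: measurable_submx. Qed.

Let mD (d : measure_display) (U : measurableType d) (f g : U -> 'cV[R]_n) :
  measurable_fun setT f -> measurable_fun setT g ->
  measurable_fun setT (fun u => f u + g u).
Proof. exact: measurable_addmx. Qed.

Let tonelli (g : 'cV[R]_n -> 'cV[R]_n -> R) :
  measurable_fun setT (fun z : RnRn => g z.1 z.2) -> (forall x y, 0 <= g x y) ->
  (\int[mu]_x \int[mu]_y (g x y)%:E = \int[mu]_y \int[mu]_x (g x y)%:E)%E.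
Proof.
move=> mg g0; apply: (fubini_tonelli (fun z : RnRn => (g z.1 z.2)%:E)) => //.
  exact/measurable_EFinP.
by move=> z; rewrite lee_fin.
Qed.

Let measurable_fst2 : measurable_fun setT (fst : RnRn -> _). Proof. exact: measurable_fst. Qed.
Let measurable_snd2 : measurable_fun setT (snd : RnRn -> _). Proof. exact: measurable_snd. Qed.

(* (x, y) |-> (x - Q x + Q y, y - Q y - Q x) is a composition of three shears,
   under each of which the law of a pair of independent copies is tilted; the
   three tilts cancel. *)
Lemma gaussian_rotation (f : 'cV[R]_n -> R) :
  measurable_fun setT f -> (forall x, 0 <= f x) ->
  (\int[mu]_y \int[mu]_x (f (x - Q *m x + Q *m y))%:E = \int[mu]_x (f x)%:E)%E.
Proof.
move=> mf f0.
have law := gaussian_shift s_neq0 mu_rect.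
have w0 h x : 0 <= tilt_mx s h x by exact: expR_ge0.
pose g1 (x y : 'cV[R]_n) := f (x + Q *m (y - Q *m x)).
have mg1 : measurable_fun setT (fun z : RnRn => g1 z.1 z.2).
  by apply: measurableT_comp => //; apply: mD => //; apply: mQ; apply: mB => //; exact: mQ.
transitivity (\int[mu]_y \int[mu]_x (g1 x y * tilt_mx s (Q *m y) x)%:E)%E.
  apply: eq_integral => y _.
  rewrite -(law (Q *m y) (g1^~ y)) => [||x]; last exact: f0.
  - apply: eq_integral => x _; congr (f _)%:E; rewrite /g1 mulmxBr QQ mulmxDr QQ.
    by rewrite [Q *m x + Q *m y]addrC opprD !addrA addrK addrAC.
  - by apply: measurableT_comp mg1 (measurable_fun_pair _ _).
rewrite -tonelli; last 2 first.
- apply: measurable_funM => //; apply: measurable_tilt_mx => //; exact: mQ.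
- by move=> x y; rewrite mulr_ge0 ?f0.
pose g2 (x y : 'cV[R]_n) := f (x + Q *m y) * tilt_mx s (Q *m (y + Q *m x)) x.
have mg2 : measurable_fun setT (fun z : RnRn => g2 z.1 z.2).
  apply: measurable_funM; first by apply: measurableT_comp => //; apply: mD => //; exact: mQ.
  by apply: measurable_tilt_mx => //; apply: mQ; apply: mD => //; exact: mQ.
transitivity (\int[mu]_x \int[mu]_y (g2 x y * tilt_mx s (- (Q *m x)) y)%:E)%E.
  apply: eq_integral => x _.
  rewrite -(law (- (Q *m x)) (g2 x)) => [||y]; last by rewrite mulr_ge0 ?f0.
  - by apply: eq_integral => y _; rewrite /g2 /g1 subrK.
  - by apply: measurableT_comp mg2 (measurable_fun_pair _ _).
rewrite tonelli; last 2 first.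
- apply: measurable_funM => //; apply: measurable_tilt_mx => //.
  by under eq_fun do rewrite -mulNmx; exact: measurable_mulmx.
- by move=> x y; rewrite !mulr_ge0 ?f0.
pose g3 (x y : 'cV[R]_n) := f x * tilt_mx s (Q *m x) (x - Q *m y) *
  tilt_mx s (Q *m y - Q *m x) y.
have mg3 : measurable_fun setT (fun z : RnRn => g3 z.1 z.2).
  apply: measurable_funM; last by apply: measurable_tilt_mx => //; apply: mB; exact: mQ.
  apply: measurable_funM; first exact: measurableT_comp.
  by apply: measurable_tilt_mx => //; [exact: mQ|apply: mB => //; exact: mQ].
transitivity (\int[mu]_y \int[mu]_x (g3 x y * tilt_mx s (Q *m y) x)%:E)%E.
  apply: eq_integral => y _.
  rewrite -(law (Q *m y) (g3^~ y)) => [||x]; last by rewrite !mulr_ge0 ?f0.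
  - apply: eq_integral => x _; rewrite /g3 /g2 addrK !mulmxDr !QQ.
    by rewrite [Q *m x + _]addrC opprD addrA subrr add0r.
  - by apply: measurableT_comp mg3 (measurable_fun_pair _ _).
transitivity (\int[mu]_y \int[mu]_x (f x)%:E)%E.
  apply: eq_integral => y _; apply: eq_integral => x _; congr EFin.
  rewrite /g3 -!mulrA -!expRD; rewrite [X in _ * X](_ : _ = 1) ?mulr1//.
  rewrite -[RHS]expR0; congr expR.
  rewrite -!mulrDl !dotpDr !dotpDl !dotpNl !dotpNr.
  rewrite !dotpQl !QQ (_ : dotp (Q *m y) x = dotp (Q *m x) y); last first.
    by rewrite dotpC dotpQl.
  by rewrite (_ : _ + _ = 0) ?mul0r//; lra.
by rewrite -[RHS]mule1 -(probability_setT mu) -integral_cst.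
Qed.

Let measurable_proj : measurable_fun setT (fun x : 'cV[R]_n => x - Q *m x).
Proof. by apply: mB => //; exact: mQ. Qed.

Let measurable_projQ : measurable_fun setT (fun x : 'cV[R]_n => Q *m x).
Proof. exact: mQ. Qed.

Let measurable_pre (f : 'cV[R]_n -> 'cV[R]_n) E : measurable_fun setT f ->
  measurable E -> measurable (f @^-1` E).
Proof. by move=> mf mE; rewrite -[X in measurable X]setTI; exact: mf. Qed.

(** Replace the Q-component of x by that of an independent copy y. The law is unchanged, while the
    indicator of the intersection becomes a product of a function of x and a function of y. *)
Lemma gaussian_proj_indep (E1 E2 : set 'cV[R]_n) :
  measurable E1 -> measurable E2 ->
  mu ((fun x : 'cV[R]_n => x - Q *m x)%R @^-1` E1 `&` mulmx Q @^-1` E2) =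
  (mu ((fun x : 'cV[R]_n => x - Q *m x)%R @^-1` E1) * mu (mulmx Q @^-1` E2))%E.
Proof.
move=> mE1 mE2; set F1 := _ @^-1` E1; set F2 := _ @^-1` E2.
have mF1 : measurable F1 by exact: measurable_pre.
have mF2 : measurable F2 by exact: measurable_pre.
have mF : measurable (F1 `&` F2) by exact: measurableI.
rewrite -[X in mu X = _]setIT -[LHS]integral_indic// -(@gaussian_rotation (\1_(F1 `&` F2)))//.
transitivity (\int[mu]_y \int[mu]_x ((\1_F2 y)%:E * (\1_F1 x)%:E))%E.
  apply: eq_integral => y _; apply: eq_integral => x _.
  rewrite -EFinM !indicE in_setI mulrC -natrM mulnb.
  have -> : (x - Q *m x + Q *m y \in F1) = (x \in F1).
    by apply/idP/idP; rewrite !inE /F1/= mulmxDr mulmxBr !QQ subrr add0r addrK.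
  have -> // : (x - Q *m x + Q *m y \in F2) = (y \in F2).
  by apply/idP/idP; rewrite !inE /F2/= mulmxDr mulmxBr !QQ subrr add0r.
under eq_integral => y _.
  rewrite ge0_integralZl//; last exact/measurable_EFinP/measurable_indicP.
  rewrite integral_indic// setIT.
  over.
rewrite ge0_integralZr//; last exact/measurable_EFinP/measurable_indicP.
by rewrite integral_indic// setIT muleC.
Qed.

End gaussian_rotation.

(** Resample, by [gaussian_rotation] with the projection on axis i, one coordinate i with a_i
    nonzero. Given the others, the hyperplane fixes that coordinate to a single point, which a
    normal law does not charge. *)
Lemma gaussian_hyperplane0 (R : realType) (n : nat) (s : R)
    (mu : probability 'cV[R]_n R) (s_neq0 : s != 0)
    (mu_rect : forall A : 'I_n -> set R, (forall i, measurable (A i)) ->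
       mu (rectangle A) = (\prod_(i < n) normal_prob 0 s (A i))%E)
    (a : 'cV[R]_n) (c : R) :
  a != 0 -> mu [set x | dotp a x = c] = 0%E.
Proof.
move=> a0.
have [i ai0] : exists i, a i 0 != 0.
  apply/existsP; apply: contraNT a0 => /existsPn a0; apply/eqP/colP => i.
  by rewrite mxE; apply/eqP; have := a0 i; rewrite negbK.
have mu_pt z : mu [set x | x i 0 = z] = 0%E.
  rewrite [X in mu X](_ : _ = rectangle (fun k : 'I_n => if k == i then [set z] else setT)); last first.
    apply/seteqP; split => x /= => [<- k|]; first by case: eqP => // ->.
    by move/(_ i); rewrite eqxx.
  rewrite mu_rect => [|k]; last by case: ifP.
  rewrite (bigD1 i)//= eqxx.
  have /null_content_dominatesP -> // := normal_prob_dominates 0 s.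
    by rewrite mul0e.
  exact: lebesgue_measure_set1.
pose Q : 'M[R]_n := delta_mx i i.
have QE (x : 'cV[R]_n) : Q *m x = x i 0 *: delta_mx i 0.
  apply/colP => k; rewrite !mxE (bigD1 i)//= big1 ?addr0 => [|j /negbTE ji].
    by rewrite !mxE eqxx andbT mulrC.
  by rewrite !mxE ji andbF mul0r.
have mdot : measurable_fun setT (dotp a : 'cV[R]_n -> R).
  by apply: measurable_dotp => //; exact: measurable_cst.
set H := [set x | _].
have mH : measurable H.
  by rewrite -[X in measurable X]setTI; exact: (mdot measurableT [set c]).
rewrite -[H]setIT -[LHS]integral_indic//.
have Qs : Q^T = Q by exact: trmx_delta.
have Qi : Q *m Q = Q by exact: mul_delta_mx.
rewrite -(@gaussian_rotation _ _ _ _ s_neq0 mu_rect Q Qs Qi (\1_H))//.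
pose f (z : 'cV[R]_n * 'cV[R]_n) := ((\1_H (z.2 - Q *m z.2 + Q *m z.1))%:E : \bar R).
have mf : measurable_fun setT f.
  apply/measurable_EFinP; apply: measurableT_comp; first exact/measurable_indicP.
  apply: measurable_addmx; last by apply: measurable_mulmx; exact: measurable_fst.
  apply: measurable_submx; first exact: measurable_snd.
  by apply: measurable_mulmx; exact: measurable_snd.
rewrite (fubini_tonelli f)//; last by move=> z; rewrite lee_fin.
rewrite integral0_eq// => x _.
pose D := [set y : 'cV[R]_n | y i 0 = (c - dotp a (x - Q *m x)) / a i 0].
have mD : measurable D.
  by rewrite -[X in measurable X]setTI; exact: (measurable_mx_entry i 0 measurableT (measurable_set1 _)).
have fE y : f (y, x) = (\1_D y)%:E.
  rewrite /f/= !indicE; congr ((nat_of_bool _)%:R%:E).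
  have dE : dotp a (x - Q *m x + Q *m y) = dotp a (x - Q *m x) + y i 0 * a i 0.
    rewrite (QE y) dotpDr; congr (_ + _).
    rewrite dotpE (bigD1 i)//= big1 ?addr0 => [|k /negbTE ki].
      by rewrite !mxE !eqxx mulr1 mulrC.
    by rewrite !mxE ki !mulr0.
  apply/idP/idP; rewrite !inE /H /D/= dE.
    by move=> <-; rewrite addrAC subrr add0r mulfK.
  by move=> ->; rewrite divfK// addrC subrK.
by under eq_integral do rewrite fE; rewrite integral_indic// setIT; exact: mu_pt.
Qed.

(** * Restriction to selected columns, and Gram matrices *)

Section column_selection.
Context {R : realType}.
Variables (p : nat) (S : {set 'I_p}).

Lemma cols_inE (n : nat) (X : 'M[R]_(n, p)) :
  cols_in S X = X *m cols_in S 1%:M.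
Proof. by rewrite /cols_in mulmx_colsub mulmx1. Qed.

Definition restrict_cv (b : 'cV[R]_p) : 'cV[R]_#|S| := \col_k b (enum_val k) 0.

Lemma tr_cols_in1_mul (b : 'cV[R]_p) : (cols_in S 1%:M)^T *m b = restrict_cv b.
Proof.
apply/colP => k; rewrite !mxE (bigD1 (enum_val k))//= big1 ?addr0 => [|j /negbTE jk].
  by rewrite !mxE eqxx mul1r.
by rewrite !mxE jk mul0r.
Qed.

Lemma cols_in1_mul_val (v : 'cV[R]_#|S|) k :
  (cols_in S 1%:M *m v) (enum_val k) 0 = v k 0.
Proof.
rewrite mxE (bigD1 k)//= big1 ?addr0 => [|l lk]; first by rewrite !mxE eqxx mul1r.
by rewrite !mxE (inj_eq enum_val_inj) eq_sym (negbTE lk) mul0r.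
Qed.

Lemma cols_in1_mul_out (v : 'cV[R]_#|S|) j :
  j \notin S -> (cols_in S 1%:M *m v) j 0 = 0.
Proof.
move=> jS; rewrite mxE big1// => l _; rewrite !mxE.
by case: eqP => [jl|]; rewrite ?mul0r//; move: jS; rewrite jl enum_valP.
Qed.

Lemma cols_in1_mul_restrict (b : 'cV[R]_p) : active_set b \subset S ->
  cols_in S 1%:M *m restrict_cv b = b.
Proof.
move=> bS; apply/colP => j; have [jS|jS] := boolP (j \in S).
  by rewrite -(enum_rankK_in jS jS) cols_in1_mul_val mxE.
rewrite cols_in1_mul_out//; apply/esym/eqP; apply: contraNT jS => bj.
by apply: (fintype.subsetP bS); rewrite inE.
Qed.

Lemma cols_in_mul_restrict (n : nat) (X : 'M[R]_(n, p)) (b : 'cV[R]_p) :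
  active_set b \subset S -> cols_in S X *m restrict_cv b = X *m b.
Proof. by move=> bS; rewrite cols_inE -mulmxA cols_in1_mul_restrict. Qed.

Lemma tr_cols_in_mul (n : nat) (X : 'M[R]_(n, p)) (y : 'cV[R]_n) :
  (cols_in S X)^T *m y = restrict_cv (X^T *m y).
Proof. by rewrite cols_inE trmx_mul -mulmxA tr_cols_in1_mul. Qed.

End column_selection.

Lemma gram_unitmx (R : realType) (n s : nat) (X : 'M[R]_(n, s)) :
  (forall v : 'cV[R]_s, X *m v = 0 -> v = 0) -> X^T *m X \in unitmx.
Proof.
move=> Xinj; rewrite -row_free_unit -kermx_eq0; apply/eqP/row_matrixP => i.
rewrite row0; set u := row i _; apply/trmx_inj; rewrite trmx0; apply: Xinj.
have uX : u *m (X^T *m X) = 0 by apply/sub_kermxP; exact: row_sub.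
have : dotp (X *m u^T) (X *m u^T) = 0.
  by rewrite /dotp trmx_mul trmxK mulmxA -(mulmxA u) uX mul0mx mxE.
rewrite dotpE => /eqP; rewrite psumr_eq0 => [/allP Xu0|i0 _]; last by rewrite -expr2 sqr_ge0.
apply/colP => k; have := Xu0 k (mem_index_enum k).
by rewrite implyTb mulf_eq0 orbb => /eqP ->; rewrite mxE.
Qed.

(** A first-order optimality condition without derivatives: if c were positive, e = r or e = c / (2
    a), whichever is smaller, would contradict the inequality. *)
Lemma le0_of_linear_le_quadratic (R : realFieldType) (a c r : R) : 0 < r -> 0 <= a ->
  (forall e, 0 < e -> e <= r -> e * c <= e ^+ 2 * a) -> c <= 0.
Proof.
move=> r0 a0 H; rewrite leNgt; apply/negP => c0.
have [ac|ac] := lerP (r * a) (c / 2).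
  have {}H : c <= r * a by rewrite -(ler_pM2l r0) mulrA -expr2 H.
  by lra.
have a0' : 0 < a by rewrite lt0r a0 andbT; apply/eqP => a00; move: ac; rewrite a00 mulr0; lra.
have e0 : 0 < c / 2 / a by rewrite !divr_gt0.
have er : c / 2 / a <= r by rewrite ler_pdivrMr// ltW.
have {}H : c <= c / 2 / a * a by rewrite -(ler_pM2l e0) mulrA -expr2 H.
by move: H; rewrite divfK ?gt_eqF//; lra.
Qed.

(** * KKT conditions of the Lasso *)

Section lasso.
Context {R : realType}.
Variables (n p : nat) (X : 'M[R]_(n, p)) (y : 'cV[R]_n) (lam : R).
Hypothesis lam_gt0 : 0 < lam.

(** Minus the gradient of the squared loss at b. *)
Definition lasso_corr (b : 'cV[R]_p) : 'cV[R]_p := X^T *m (y - X *m b).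

Definition lasso_kkt (b : 'cV[R]_p) : Prop :=
  (forall j, b j 0 != 0 -> lasso_corr b j 0 = lam * Num.sg (b j 0)) /\
  (forall j, `|lasso_corr b j 0| <= lam).

Lemma lasso_objectiveD b v : lasso_objective X y lam (b + v) =
  lasso_objective X y lam b - dotp (lasso_corr b) v
  + 2^-1 * dotp (X *m v) (X *m v)
  + lam * \sum_j (`|b j 0 + v j 0| - `|b j 0|).
Proof.
have sqE (z : 'cV[R]_n) : \sum_i z i 0 ^+ 2 = dotp z z.
  by rewrite dotpE; apply: eq_bigr => i _; rewrite expr2.
rewrite /lasso_objective !sqE sumrB.
have -> : \sum_j `|(b + v) j 0| = \sum_j `|b j 0 + v j 0|.
  by apply: eq_bigr => j _; rewrite mxE.
have -> : dotp (lasso_corr b) v = dotp (y - X *m b) (X *m v).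
  by rewrite /dotp /lasso_corr trmx_mul trmxK mulmxA.
have -> : y - X *m (b + v) = (y - X *m b) - X *m v by rewrite mulmxDr opprD addrA.
move: (y - X *m b) (X *m v) => r w.
by rewrite !dotpDl !dotpDr !dotpNl !dotpNr (dotpC w r); lra.
Qed.

(** Convexity: the correlation is lam times a subgradient of the l1 norm at b, so the linear term of
    [lasso_objectiveD] is dominated by the penalty and the quadratic term is nonnegative. *)
Lemma lasso_kkt_min b v : lasso_kkt b ->
  lasso_objective X y lam b <= lasso_objective X y lam v.
Proof.
move=> [bE ble]; rewrite -[v](subrK b) addrC lasso_objectiveD.
move: (v - b) => {v} v.
have : dotp (lasso_corr b) v <= lam * \sum_j (`|b j 0 + v j 0| - `|b j 0|).
  rewrite dotpE mulr_sumr; apply: ler_sum => j _.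
  have gv z : lasso_corr b j 0 * z <= lam * `|z|.
    by rewrite (le_trans (ler_norm _))// normrM ler_wpM2r.
  have -> : lam * (`|b j 0 + v j 0| - `|b j 0|) =
      lam * `|b j 0 + v j 0| - lasso_corr b j 0 * b j 0.
    rewrite mulrBr; congr (_ - _); have [->|bj] := eqVneq (b j 0) 0.
      by rewrite normr0 !mulr0.
    by rewrite bE// -mulrA -normrEsg.
  by rewrite lerBrDr -mulrDr [v j 0 + _]addrC gv.
have : 0 <= dotp (X *m v) (X *m v).
  by rewrite dotpE; apply: sumr_ge0 => i _; rewrite -expr2 sqr_ge0.
lra.
Qed.

Lemma lasso_kkt_uniq b b' : is_lasso X y lam b -> lasso_kkt b' -> b' = b.
Proof.
move=> lb kb'; apply/eqP; apply/negPn/negP => /lb.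
by rewrite ltNge lasso_kkt_min.
Qed.

(** Perturb a single coordinate by a small t of either sign. While |t| <= |b_j| the penalty is
    linear in t, which gives equality on active coordinates; elsewhere the triangle inequality gives
    the bound. *)
Lemma is_lasso_kkt b : is_lasso X y lam b -> lasso_kkt b.
Proof.
move=> lb.
have step j t : t * lasso_corr b j 0 <=
    t ^+ 2 * (2^-1 * dotp (X *m delta_mx j 0) (X *m delta_mx j 0))
    + lam * (`|b j 0 + t| - `|b j 0|).
  have : lasso_objective X y lam b <= lasso_objective X y lam (b + t *: delta_mx j 0).
    have [->//|bt] := eqVneq (b + t *: delta_mx j 0) b; exact/ltW/lb.
  rewrite lasso_objectiveD.
  have dotZ m (u w : 'cV[R]_m) : dotp (t *: u) w = t * dotp u w.
    by rewrite !dotpE mulr_sumr; apply: eq_bigr => i _; rewrite mxE mulrA.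
  have -> : dotp (lasso_corr b) (t *: delta_mx j 0) = t * lasso_corr b j 0.
    rewrite dotpC dotZ dotpE (bigD1 j)//= big1 ?addr0 => [|k /negbTE kj].
      by rewrite !mxE !eqxx mul1r.
    by rewrite !mxE kj mul0r.
  rewrite -scalemxAr !dotZ [dotp _ (t *: _)]dotpC dotZ.
  have -> : \sum_i (`|b i 0 + (t *: (delta_mx j 0 : 'cV[R]_p)) i 0| - `|b i 0|) =
      `|b j 0 + t| - `|b j 0|.
    rewrite (bigD1 j)//= big1 ?addr0 => [|k /negbTE kj].
      by rewrite !mxE !eqxx mulr1.
    by rewrite !mxE kj mulr0 addr0 subrr.
  by lra.
have a0 j : 0 <= 2^-1 * dotp (X *m delta_mx j 0) (X *m delta_mx j 0).
  by rewrite mulr_ge0// dotpE; apply: sumr_ge0 => i _; rewrite -expr2 sqr_ge0.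
split=> j.
  move=> bj; have r0 : 0 < `|b j 0| by rewrite normr_gt0.
  have sgE t : `|t| <= `|b j 0| -> `|b j 0 + t| - `|b j 0| = t * Num.sg (b j 0).
    have [bp|bn|b0] := ltgtP 0 (b j 0); last by rewrite -b0 eqxx in bj.
      rewrite (gtr0_norm bp) (gtr0_sg bp) ler_norml => /andP[tb _]; rewrite ger0_norm; lra.
    rewrite (ltr0_norm bn) (ltr0_sg bn) ler_norml => /andP[_ tb]; rewrite ler0_norm; lra.
  apply/eqP; rewrite eq_le; apply/andP; split; rewrite -subr_le0;
      apply: (le0_of_linear_le_quadratic r0 (a0 j)) => e e0 er.
    by have := step j e; rewrite sgE ?(gtr0_norm e0)//; lra.
  by have := step j (- e); rewrite sgE ?normrN ?(gtr0_norm e0)// sqrrN; lra.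
rewrite ler_norml; apply/andP; split; rewrite -subr_le0;
    apply: (le0_of_linear_le_quadratic ltr01 (a0 j)) => e e0 _.
  have := step j (- e); have := ler_wpM2l (ltW lam_gt0) (ler_normD (b j 0) (- e)).
  by rewrite normrN (gtr0_norm e0) sqrrN; lra.
have := step j e; have := ler_wpM2l (ltW lam_gt0) (ler_normD (b j 0) e).
by rewrite (gtr0_norm e0); lra.
Qed.

(* Moving along a kernel vector supported on the active set preserves the KKT
   conditions as long as no sign changes, contradicting uniqueness. *)
Lemma is_lasso_inj b (v : 'cV[R]_#|active_set b|) : is_lasso X y lam b ->
  cols_in (active_set b) X *m v = 0 -> v = 0.
Proof.
move=> lb; rewrite cols_inE -mulmxA; set c := _ *m v => Xc0.
have [bE ble] := is_lasso_kkt lb.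
(* K exceeds every ratio |c_j| / |b_j| over active j, so the step c / K flips no sign. *)
pose K := 1 + \sum_(j in active_set b) `|c j 0| / `|b j 0|.
have K1 : 1 <= K by rewrite lerDl sumr_ge0// => j _; rewrite divr_ge0.
have K0 : 0 < K by rewrite (lt_le_trans ltr01).
have corrE : lasso_corr (b + K^-1 *: c) = lasso_corr b.
  by rewrite /lasso_corr (mulmxDr X) -scalemxAr Xc0 scaler0 addr0.
have bcE j : (b + K^-1 *: c) j 0 = b j 0 + K^-1 * c j 0.
  by rewrite mxE [X in _ + X]mxE.
have kkt : lasso_kkt (b + K^-1 *: c).
  split=> j; rewrite corrE// !bcE => bcj.
  have [jS|jS] := boolP (j \in active_set b); last first.
    rewrite bE; first by rewrite cols_in1_mul_out// mulr0 addr0.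
    by move: bcj; rewrite cols_in1_mul_out// mulr0 addr0.
  have bj : b j 0 != 0 by move: jS; rewrite inE.
  rewrite bE//; congr (_ * _).
  have : `|K^-1 * c j 0| < `|b j 0|.
    rewrite normrM gtr0_norm ?invr_gt0// mulrC ltr_pdivrMr// mulrC.
    rewrite -ltr_pdivrMr ?normr_gt0// /K (bigD1 j)//= addrCA ltrDl.
    by rewrite (lt_le_trans ltr01)// lerDl sumr_ge0// => k _; rewrite divr_ge0.
  move: (K^-1 * _) => t; rewrite ltr_norml.
  have [bp|bn|b0] := ltgtP 0 (b j 0); last by rewrite -b0 eqxx in bj.
    by rewrite (gtr0_norm bp) => /andP[? _]; rewrite !gtr0_sg//; lra.
  by rewrite (ltr0_norm bn) => /andP[_ ?]; rewrite !ltr0_sg//; lra.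
have /eqP := lasso_kkt_uniq lb kkt.
rewrite -subr_eq0 addrAC subrr add0r scaler_eq0 invr_eq0 gt_eqF//= => /eqP c0.
by apply/colP => k; rewrite -(cols_in1_mul_val v k) -/c c0 !mxE.
Qed.

End lasso.

(** * Active and inactive constraints and the projection separating them *)

Section lasso_selection.
Context {R : realType}.
Variables (n p : nat) (X : 'M[R]_(n, p)) (I : {set 'I_n}) (lam : R).
Variable S : {set 'I_p}.

Lemma rows_inE (q : nat) (M : 'M[R]_(n, q)) : rows_in I M = rows_in I 1%:M *m M.
Proof. by rewrite /rows_in mul_rowsub_mx mul1mx. Qed.

Local Notation Rw := (rows_in I (1%:M : 'M[R]_n)).
Local Notation X1 := (rows_in I X).
Local Notation X1S := (cols_in S X1).
Local Notation G := (X1S^T *m X1S).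

Lemma rows_in1_mul_tr : Rw *m Rw^T = 1%:M.
Proof.
apply/matrixP => k l; rewrite !mxE (bigD1 (enum_val k))//= big1 ?addr0 => [|i /negbTE ik].
  by rewrite !mxE eqxx mul1r (inj_eq enum_val_inj) eq_sym.
by rewrite !mxE eq_sym ik mul0r.
Qed.

Lemma cols_rows_in : X1S = Rw *m cols_in S X.
Proof. by rewrite cols_inE rows_inE -mulmxA -cols_inE. Qed.

(* The Lasso coefficients on S if S and the signs xi are the selected ones. *)
Definition lasso_fit (xi : 'cV[R]_#|S|) (y : 'cV[R]_n) : 'cV[R]_#|S| :=
  invmx G *m (X1S^T *m rows_in I y - lam *: xi).

(** The KKT bound at the candidate solution, [lasso_fit] extended by zero: these are the
    inequalities that A Y <= b leaves out. *)
Definition inactive_constraints (xi : 'cV[R]_#|S|) : set 'cV[R]_n :=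
  [set y | forall j, `|lasso_corr X1 (rows_in I y)
                        (cols_in S 1%:M *m lasso_fit xi y) j 0| <= lam].

(** A Y <= b says that the candidate coefficients have the signs xi, in the weak sense. *)
Lemma active_constraintsE xi : active_constraints X I lam xi =
  [set y | forall k, 0 <= xi k 0 * lasso_fit xi y k 0].
Proof.
have diagE (u : 'cV[R]_#|S|) k : (diag_mx xi^T *m u) k 0 = xi k 0 * u k 0.
  by rewrite mul_diag_mx !mxE.
have cE y k : (- diag_mx xi^T *m invmx G *m X1S^T *m rows_in I y) k 0 <=
      (- lam *: (diag_mx xi^T *m invmx G *m xi)) k 0 =
    (0 <= xi k 0 * lasso_fit xi y k 0).
  rewrite -!mulmxA mulNmx [X in X <= _]mxE [X in _ <= X]mxE !diagE.
  rewrite /lasso_fit mulmxBr -scalemxAr.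
  rewrite [X in _ = (0 <= _ * X)]mxE [X in _ = (0 <= _ * (_ + X))]mxE.
  rewrite [X in _ = (0 <= _ * (_ - X))]mxE.
  by apply/idP/idP; nra.
by rewrite /active_constraints; apply/seteqP; split => y /= H k; have := H k; rewrite cE.
Qed.

(** Residual projection of the regression of the selection rows on X_{1,S}, embedded into R^n by
    zero on the other rows. *)
Definition lasso_proj : 'M[R]_n :=
  Rw^T *m (1%:M - X1S *m invmx G *m X1S^T) *m Rw.

Hypothesis G_unit : G \in unitmx.

Let GT : (invmx G)^T = invmx G.
Proof. by rewrite trmx_inv trmx_mul trmxK. Qed.

Let X1S_proj : X1S^T *m (1%:M - X1S *m invmx G *m X1S^T) = 0.
Proof. by rewrite mulmxBr mulmx1 !mulmxA mulmxV// mul1mx subrr. Qed.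

Lemma lasso_proj_sym : lasso_proj^T = lasso_proj.
Proof.
rewrite /lasso_proj 2!trmx_mul trmxK mulmxA; congr (_ *m _ *m _).
by rewrite linearB /= trmx1 !trmx_mul trmxK GT mulmxA.
Qed.

Lemma lasso_proj_idem : lasso_proj *m lasso_proj = lasso_proj.
Proof.
have idem : (1%:M - X1S *m invmx G *m X1S^T) *m (1%:M - X1S *m invmx G *m X1S^T) =
    1%:M - X1S *m invmx G *m X1S^T.
  by rewrite mulmxBl mul1mx -[X in _ - X]mulmxA X1S_proj mulmx0 subr0.
rewrite /lasso_proj; move: (1%:M - _) idem => M idem.
by rewrite -!mulmxA (mulmxA Rw) rows_in1_mul_tr mul1mx (mulmxA M) idem.
Qed.

(** Since Q only sees the selection rows, orthogonality to X_{1,S} is orthogonality to the full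
    columns X_S. Hence statistics built from X_S^T y, which use all rows, also ignore Q y. *)
Lemma tr_cols_in_lasso_proj : (cols_in S X)^T *m lasso_proj = 0.
Proof.
by rewrite /lasso_proj !mulmxA -trmx_mul -cols_rows_in X1S_proj mul0mx.
Qed.

Lemma rows_in_lasso_proj :
  Rw *m lasso_proj = (1%:M - X1S *m invmx G *m X1S^T) *m Rw.
Proof. by rewrite /lasso_proj !mulmxA rows_in1_mul_tr mul1mx. Qed.

Lemma lasso_proj_cols_in (v : 'cV[R]_#|S|) : lasso_proj *m (cols_in S X *m v) = 0.
Proof.
apply/trmx_inj; rewrite trmx_mul lasso_proj_sym trmx_mul -mulmxA tr_cols_in_lasso_proj.
by rewrite mulmx0 trmx0.
Qed.

Lemma lasso_fit_sub_proj xi y : lasso_fit xi (y - lasso_proj *m y) = lasso_fit xi y.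
Proof.
rewrite /lasso_fit; congr (_ *m (_ - _)).
rewrite (rows_inE (_ - _)) (mulmxBr Rw) -(rows_inE y) (mulmxA Rw) rows_in_lasso_proj.
by rewrite (mulmxBr X1S^T) -(mulmxA _ Rw y) (mulmxA X1S^T) X1S_proj mul0mx subr0.
Qed.

(** The residual at the candidate solution is the projected data plus a constant vector, so only Q y
    enters. *)
Lemma inactive_constraints_proj xi :
  mulmx lasso_proj @^-1` inactive_constraints xi = inactive_constraints xi.
Proof.
have cE y : lasso_corr X1 (rows_in I y) (cols_in S 1%:M *m lasso_fit xi y) =
    X1^T *m (rows_in I (lasso_proj *m y) + X1S *m (invmx G *m (lam *: xi))).
  rewrite /lasso_corr; congr (_ *m _).
  rewrite [X1 *m (_ *m _)]mulmxA -cols_inE /lasso_fit.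
  rewrite (rows_inE (lasso_proj *m y)) (rows_inE y) (mulmxA Rw lasso_proj) rows_in_lasso_proj.
  rewrite mulmxBr (mulmxBr X1S) opprB addrCA addrC; congr (_ + _).
  by rewrite !mulmxBl mul1mx !mulmxA.
by apply/seteqP; split => y /= H j; have := H j; rewrite !cE [lasso_proj *m (_ *m _)]mulmxA lasso_proj_idem.
Qed.

Lemma measurable_rows_in : measurable_fun setT (fun y : 'cV[R]_n => rows_in I y).
Proof.
rewrite (_ : (fun y => rows_in I y) = mulmx Rw).
  exact: (measurable_mulmx _ (@measurable_id _ _ setT)).
by apply/funext => y; rewrite rows_inE.
Qed.

Lemma measurable_lasso_fit xi : measurable_fun setT (lasso_fit xi).
Proof.
apply: measurable_mulmx; apply: measurable_submx; last exact: measurable_cst.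
exact: measurable_mulmx measurable_rows_in.
Qed.

Lemma measurable_inactive xi : measurable (inactive_constraints xi).
Proof.
have -> : inactive_constraints xi = \bigcap_(j in [set: 'I_p])
   ((fun y => `|lasso_corr X1 (rows_in I y)
                        (cols_in S 1%:M *m lasso_fit xi y) j 0|) @^-1` `]-oo, lam]).
  by apply/seteqP; split => y /= H j => [_|]; have := H j; rewrite /= in_itv/=; apply.
apply: fin_bigcap_measurable => [|j _]; first exact: finite_finset.
rewrite -[X in measurable X]setTI; apply: measurableT_comp => //.
apply: (measurableT_comp (measurable_mx_entry j 0)).
apply: measurable_mulmx; apply: measurable_submx.
  exact: measurable_rows_in.
do 2!apply: measurable_mulmx; exact: measurable_lasso_fit.
Qed.

Lemma measurable_sign_constraints (xi : 'cV[R]_#|S|) :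
  measurable [set y | forall k, 0 < xi k 0 * lasso_fit xi y k 0] /\
  measurable [set y | forall k, 0 <= xi k 0 * lasso_fit xi y k 0].
Proof.
have m k : measurable_fun setT (fun y => xi k 0 * lasso_fit xi y k 0).
  apply: measurable_funM => //.
  exact: measurableT_comp (measurable_mx_entry k 0) (measurable_lasso_fit xi).
split.
  have -> : [set y | forall k, 0 < xi k 0 * lasso_fit xi y k 0] =
    \bigcap_(k in [set: 'I_#|S|]) ((fun y => xi k 0 * lasso_fit xi y k 0) @^-1` `]0, +oo[).
    by apply/seteqP; split => y /= H k => [_|]; have := H k; rewrite /= in_itv/= andbT; apply.
  apply: fin_bigcap_measurable => [|j _]; first exact: finite_finset.
  by rewrite -[X in measurable X]setTI; apply: m.
have -> : [set y | forall k, 0 <= xi k 0 * lasso_fit xi y k 0] =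
  \bigcap_(k in [set: 'I_#|S|]) ((fun y => xi k 0 * lasso_fit xi y k 0) @^-1` `[0, +oo[).
  by apply/seteqP; split => y /= H k => [_|]; have := H k; rewrite /= in_itv/= andbT; apply.
apply: fin_bigcap_measurable => [|j _]; first exact: finite_finset.
by rewrite -[X in measurable X]setTI; apply: m.
Qed.

End lasso_selection.

(** * The event of selecting given signs *)

Section selection_event.
Context {R : realType}.
Variables (n p : nat) (X : 'M[R]_(n, p)) (I : {set 'I_n}) (lam : R).
Hypothesis lam_gt0 : 0 < lam.
Variable bhat : 'cV[R]_n -> 'cV[R]_p.
Hypothesis bhat_lasso : forall y, is_lasso (rows_in I X) (rows_in I y) lam (bhat y).
Variable b0 : 'cV[R]_p.
Hypothesis b0_sg : forall j, Num.sg (b0 j 0) = b0 j 0.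

Local Notation S := (active_set b0).
Local Notation X1S := (cols_in S (rows_in I X)).
Local Notation xi := (sign_vector b0).

(** By [b0_sg], [b0] has entries in {-1, 0, 1}; it fixes both the selected set and the signs. *)
Definition selection_event : set 'cV[R]_n :=
  [set y | forall j, Num.sg (bhat y j 0) = b0 j 0].

Let active_bhat y : selection_event y -> active_set (bhat y) = S.
Proof. by move=> sy; apply/setP => j; rewrite !inE -sgr_eq0 sy. Qed.

Lemma selection_gram_unitmx y : selection_event y -> X1S^T *m X1S \in unitmx.
Proof.
move=> /active_bhat <-; apply: gram_unitmx => v.
exact: (is_lasso_inj lam_gt0 (@bhat_lasso y)).
Qed.

Let xiE k : xi k 0 = b0 (enum_val k) 0.
Proof. by rewrite mxE b0_sg. Qed.

(** Forward, stationarity on S is a linear system whose solution is [lasso_fit]. Backward,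
    [lasso_fit] extended by zero satisfies the KKT conditions, so by uniqueness it is the
    estimate. *)
Lemma selection_eventE : X1S^T *m X1S \in unitmx ->
  selection_event = [set y | forall k, 0 < xi k 0 * lasso_fit X I lam xi y k 0] `&`
                    inactive_constraints X I lam xi.
Proof.
move=> Gu; apply/seteqP; split => y.
  move=> sy; have aE := active_bhat sy; have [kE kle] := is_lasso_kkt lam_gt0 (@bhat_lasso y).
  have nz (k : 'I_#|S|) : bhat y (enum_val k) 0 != 0.
    have : enum_val k \in active_set (bhat y) by rewrite aE enum_valP.
    by rewrite inE.
  have rE : cols_in S 1%:M *m restrict_cv S (bhat y) = bhat y.
    by apply: cols_in1_mul_restrict; rewrite aE.
  have fE : lasso_fit X I lam xi y = restrict_cv S (bhat y).
    have E : restrict_cv S (lasso_corr (rows_in I X) (rows_in I y) (bhat y)) = lam *: xi.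
      apply/colP => k; rewrite mxE kE.
        by rewrite sy mxE xiE.
      exact: nz.
    rewrite /lasso_fit -E /lasso_corr -tr_cols_in_mul [X in _ - X]mulmxBr opprB addrCA subrr addr0.
    by rewrite -(@cols_in_mul_restrict _ _ S) ?aE// (mulmxA X1S^T) (mulmxA (invmx _)) mulVmx// mul1mx.
  split; last by move=> j; rewrite fE rE.
  move=> k; rewrite fE xiE [restrict_cv _ _ k 0]mxE -sy -normrEsg normr_gt0.
  exact: nz.
move=> [sy iy]; pose f := lasso_fit X I lam xi y.
have sgf k : Num.sg (f k 0) = xi k 0.
  have sgxi : Num.sg (xi k 0) = xi k 0 by rewrite xiE b0_sg.
  have : Num.sg (xi k 0 * f k 0) = 1 by rewrite gtr0_sg//; exact: sy.
  rewrite sgrM sgxi.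
  have [fp|fn|<-] := ltgtP 0 (f k 0); last by rewrite sgr0 mulr0; lra.
    by rewrite gtr0_sg// mulr1.
  by rewrite ltr0_sg// mulrN1 => <-; rewrite opprK.
have corrE : restrict_cv S (lasso_corr (rows_in I X) (rows_in I y)
    (cols_in S 1%:M *m f)) = lam *: xi.
  rewrite /lasso_corr -tr_cols_in_mul mulmxBr [rows_in I X *m _]mulmxA -cols_inE.
  rewrite [X in _ - X]mulmxA /f /lasso_fit [X in _ - X]mulmxA mulmxV// mul1mx.
  by rewrite opprB addrCA subrr addr0.
have bE : cols_in S 1%:M *m f = bhat y.
  apply: lasso_kkt_uniq (@bhat_lasso y) _; split => // j bj.
  have jS : j \in S by apply: contraNT bj => jS; rewrite cols_in1_mul_out.
  rewrite -(enum_rankK_in jS jS) cols_in1_mul_val sgf.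
  have := congr1 (fun M : 'cV_#|S| => M (enum_rank_in jS j) 0) corrE.
  by rewrite /= mxE => ->; rewrite mxE.
move=> j; rewrite -bE; have [jS|jS] := boolP (j \in S).
  by rewrite -(enum_rankK_in jS jS) cols_in1_mul_val sgf xiE.
by rewrite cols_in1_mul_out// sgr0; move: jS; rewrite inE negbK => /eqP.
Qed.

(** No regularity of [bhat] is assumed: the event is described by inequalities if the Gram matrix is
    invertible and is empty otherwise. *)
Lemma measurable_selection_event : measurable selection_event.
Proof.
have [Gu|nGu] := boolP (X1S^T *m X1S \in unitmx).
  rewrite selection_eventE//; apply: measurableI; last exact: measurable_inactive.
  exact: (measurable_sign_constraints _ _ _ _).1.
have -> // : selection_event = set0.
by apply/seteqP; split => y // /selection_gram_unitmx; rewrite (negbTE nGu).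
Qed.

End selection_event.

(** * Tail probabilities of a statistic are superuniform *)

Section tail_superuniform.
Context {R : realType} {d : measure_display} {T : measurableType d}.
Variables (mu : {measure set T -> \bar R}) (f : T -> R).
Hypothesis mf : measurable_fun setT f.

Let upper e := [set x | e <= f x].

Let measurable_upper e : measurable (upper e).
Proof.
rewrite (_ : upper e = f @^-1` `[e, +oo[); last first.
  by apply/seteqP; split => x; rewrite /upper/= in_itv/= andbT.
by rewrite -[X in measurable X]setTI; exact: mf.
Qed.

(** The thresholds e whose upper tail has mass at most u form an up-set U, and the event is the
    preimage of U. If U has a least element the event is one such tail; otherwise it is an
    increasing limit of sets contained in such tails. Atoms are allowed. *)
Lemma tail_superuniform (u : \bar R) : (0 <= u)%E ->
  (mu [set x | mu [set x' | (f x <= f x')%R] <= u] <= u)%E.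
Proof.
move=> u0; pose U := [set e | (mu (upper e) <= u)%E].
have Uup e e' : U e -> e <= e' -> U e'.
  move=> Ue ee'; apply: le_trans Ue; apply: le_measure; rewrite ?inE//.
  by move=> x; exact: le_trans.
rewrite -[X in mu X]/(f @^-1` U).
have [[a [Ua amin]]|nomin] := pselect (exists a, U a /\ forall e, U e -> a <= e).
  suff -> : f @^-1` U = upper a by [].
  by apply/seteqP; split => x /= => [/amin|ax]//; exact: Uup Ua ax.
(* U has no minimum, so it is exhausted by its rational elements. *)
pose F k := if unpickle k is Some q then
  (if `[< U (ratr (q : rat)) >] then upper (ratr q) else set0) else set0.
have mF k : measurable (F k) by rewrite /F; case: unpickle => // q; case: ifP.
have UF : f @^-1` U = \bigcup_k F k.
  apply/seteqP; split => x /=.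
    move=> Ux; have [e [Ue ex]] : exists e, U e /\ e < f x.
      apply: contrapT => H; apply: nomin; exists (f x); split => // e Ue.
      by rewrite leNgt; apply/negP => ex; apply: H; exists e.
    have [q /itvP qe] := rat_in_itvoo ex.
    exists (pickle q); [exact: I|rewrite /F pickleK]; case: asboolP => [_|[]].
      by rewrite /upper/= qe.
    by apply: Uup Ue _; rewrite qe.
  move=> [k _]; rewrite /F; case: unpickle => // q; case: asboolP => // Uq.
  exact: Uup.
(* A finite union lies in the tail at the least of its rationals, which is in U; if the union is
   empty, e is an arbitrary value. *)
have Fle n : exists e, (\big[setU/set0]_(k < n) F k `<=` upper e /\ U e) \/
    \big[setU/set0]_(k < n) F k = set0.
  elim: n => [|n [e IH]]; first by exists 0; right; rewrite big_ord0.
  rewrite big_ord_recr/= {2 4}/F.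
  case: unpickle => [q|]; last by rewrite setU0; exists e.
  case: asboolP => Uq; last by rewrite setU0; exists e.
  case: IH => [[Fe Ue]|->]; last by exists (ratr q); left; rewrite set0U; split.
  exists (Num.min e (ratr q)); left; split; last by rewrite minEle; case: ifP.
  rewrite subUset; split=> x.
    by move=> /Fe; rewrite /upper/= ge_min => ->.
  by rewrite /upper/= ge_min => ->; rewrite orbT.
rewrite UF -(bigcup_bigsetU_bigcup F).
have mUF : measurable (\bigcup_n \big[setU/set0]_(k < n.+1) F k).
  by apply: bigcupT_measurable => n; exact: bigsetU_measurable.
have mFn n : measurable (\big[setU/set0]_(k < n.+1) F k) by exact: bigsetU_measurable.
have ndF : nondecreasing_seq (fun n => \big[setU/set0]_(k < n.+1) F k).
  by move=> m n mn; apply/subsetPset; exact: (@subset_bigsetU _ F m.+1 n.+1).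
have Fcvg := nondecreasing_cvg_mu (mu := mu) mFn mUF ndF.
rewrite -(cvg_lim _ Fcvg)//; apply: lime_le; first exact: cvgP Fcvg.
apply: nearW => n /=; have [e [[Fe Ue]|->]] := Fle n.+1; last by rewrite measure0.
apply: le_trans Ue; by apply: le_measure; rewrite ?inE//; exact: mFn.
Qed.

End tail_superuniform.

(** * Measurability of p-values defined by kernels *)

Section kernel_pullback.
Context {R : realType} {d1 d2 d3 : measure_display}.
Context {T1 : measurableType d1} {T2 : measurableType d2} {T3 : measurableType d3}.
Variable k : R.-pker T2 ~> T3.
Variables (f : T1 -> T2) (mf : measurable_fun setT f).

Definition kpullback (_ : measurable_fun setT f) (x : T1) :
  {measure set T3 -> \bar R} := k (f x).

Let measurable_kpullback U : measurable U ->
  measurable_fun setT (kpullback mf ^~ U).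
Proof. by move=> mU; exact: measurableT_comp (measurable_kernel k U mU) mf. Qed.

HB.instance Definition _ :=
  isKernel.Build _ _ _ _ R (kpullback mf) measurable_kpullback.

Let kpullback_prob x : kpullback mf x setT = 1%E.
Proof. exact: prob_kernel. Qed.

HB.instance Definition _ :=
  Kernel_isProbability.Build _ _ _ _ R (kpullback mf) kpullback_prob.

End kernel_pullback.

Section kernel_tail.
Context {R : realType} {d d' : measure_display}.
Context {Omega : measurableType d} {V : measurableType d'}.
Variables (kap : R.-pker V ~> Omega) (eta : Omega -> R).
Hypothesis meta : measurable_fun setT eta.

(** The conditioning value and the observation are separate arguments, so that the first can be
    frozen while the second varies over the fibre; the p-value is the value at (T w, w). *)
Definition kernel_tail (z : V * Omega) : \bar R :=
  kap z.1 [set w | eta z.2 <= eta w].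

Lemma measurable_kernel_tail : measurable_fun setT kernel_tail.
Proof.
pose A := [set z : (V * Omega) * Omega | eta z.1.2 <= eta z.2].
have mA : measurable A.
  have m12 : measurable_fun setT (fun z : (V * Omega) * Omega => eta z.1.2).
    exact: measurableT_comp meta (measurableT_comp measurable_snd measurable_fst).
  have m2 : measurable_fun setT (fun z : (V * Omega) * Omega => eta z.2).
    exact: measurableT_comp meta measurable_snd.
  have := measurable_fun_ler m12 m2 measurableT (Y := [set true]).
  by rewrite setTI; apply.
have mfst : measurable_fun setT (fst : V * Omega -> V) by exact: measurable_fst.
have := measurable_fun_xsection_finite_kernel (kpullback kap mfst) (A := A).
rewrite inE => /(_ mA); congr measurable_fun; apply/funext => z.
by congr (kap _ _); apply/seteqP; split => w; rewrite /xsection/= inE.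
Qed.

Lemma measurable_kernel_tail_le (u : \bar R) :
  measurable [set z | (kernel_tail z <= u)%E].
Proof.
rewrite (_ : mkset _ = kernel_tail @^-1` `]-oo, u]%classic); last first.
  by apply/seteqP; split => z /=; rewrite in_itv.
rewrite -[X in measurable X]setTI; apply: measurable_kernel_tail => //.
exact: emeasurable_itv.
Qed.

Lemma measurable_pvalue_le (T : Omega -> V) (pval : Omega -> R) (u : R) :
  measurable_fun setT T -> (forall w, (pval w)%:E = kernel_tail (T w, w)) ->
  measurable [set w | pval w <= u].
Proof.
move=> mT pvalE.
rewrite (_ : mkset _ = (fun w => (T w, w)) @^-1` [set z | (kernel_tail z <= u%:E)%E]).
  have mg : measurable_fun setT (fun w => (T w, w)) by exact: measurable_fun_pair.
  by rewrite -[X in measurable X]setTI; apply: mg => //; exact: measurable_kernel_tail_le.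
by apply/seteqP; split => w; rewrite /= -pvalE lee_fin.
Qed.

End kernel_tail.

(** * Disintegration along the conditioning variable *)

Section disintegration.
Context {R : realType} {d d' : measure_display}.
Context {Omega : measurableType d} {V : measurableType d'}.
Variables (mu : probability Omega R) (T : Omega -> V) (C : set Omega).
Variable kap : R.-pker V ~> Omega.
Hypotheses (mT : measurable_fun setT T) (mC : measurable C).
Hypothesis kap_law : cond_law mu T C kap.
Local Open Scope ereal_scope.

(** The law, on C, of T w paired with a fresh draw from [kap] at T w. *)
Definition joint_law (H : set (V * Omega)) : \bar R :=
  \int[mu]_(w in C) kap (T w) (xsection H (T w)).

Let measurable_section (H : set (V * Omega)) : measurable H ->
  measurable_fun C (fun w => kap (T w) (xsection H (T w))).
Proof.
move=> mH; apply: measurable_funTS.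
apply: (measurableT_comp (f := fun v => kap v (xsection H v))) => //.
by apply: measurable_fun_xsection_finite_kernel; rewrite inE.
Qed.

Let joint_law0 : joint_law set0 = 0.
Proof. by apply: integral0_eq => w _; rewrite xsection0 measure0. Qed.

Let joint_law_ge0 H : 0 <= joint_law H.
Proof. by apply: integral_ge0. Qed.

Let joint_law_sigma_additive : semi_sigma_additive joint_law.
Proof.
move=> F mF tF mUF.
rewrite [X in _ --> X](_ : _ = \sum_(n <oo) joint_law (F n)).
  by apply: is_cvg_ereal_nneg_natsum => n _; exact: joint_law_ge0.
rewrite -integral_nneseries//; last by move=> n; exact: measurable_section.
apply: eq_integral => w _; rewrite xsection_bigcup.
apply: measure_semi_bigcup => [i||]; first exact: measurable_xsection.
  exact: trivIset_xsection.
by apply: bigcupT_measurable => i; exact: measurable_xsection.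
Qed.

HB.instance Definition _ := isMeasure.Build _ _ _
  joint_law joint_law0 joint_law_ge0 joint_law_sigma_additive.

(** [cond_law] is this identity on products of measurable sets; a pi-system argument extends it to
    events coupling T w with w, such as a bound on the p-value. *)
Lemma cond_law_disintegration (H : set (V * Omega)) : measurable H ->
  mu ([set w | H (T w, w)] `&` C) = joint_law H.
Proof.
move=> mH; pose g w := (T w, w).
have mg : measurable_fun setT g by exact: measurable_fun_pair.
pose nu := pushforward (mrestr mu mC) g.
rewrite -[LHS]/(nu H).
apply: (measure_unique [set A `*` B | A in measurable & B in measurable]
  (fun=> setT)) => //.
- by rewrite measurable_prod_measurableType.
- move=> _ _ [A mA [B mB <-]] [A' mA' [B' mB' <-]].
  exists (A `&` A'); first exact: measurableI.
  by exists (B `&` B'); [exact: measurableI|rewrite setXI].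
- by move=> _; exists setT => //; exists setT => //; rewrite setXTT.
- by rewrite bigcup_const.
- move=> _ [A mA [B mB <-]].
  have := kap_law mB mA.
  have -> : B `&` (T @^-1` A `&` C) = g @^-1` (A `*` B) `&` C.
    by apply/seteqP; split => w /=; [move=> [? [? ?]]|move=> [[? ?] ?]].
  move=> nuE; apply: (etrans nuE).
  rewrite integral_mkcondl; apply: eq_integral => w _.
  rewrite patchE; case: ifPn => [|]; rewrite ?inE ?notin_setE => TA.
    by rewrite in_xsectionX ?inE.
  by rewrite notin_xsectionX ?measure0// notin_setE.
- move=> _; rewrite -[X in X < _]/(mu (setT `&` C)) setTI.
  by rewrite (le_lt_trans (probability_le1 _ _))// ltry.
Qed.

Lemma cond_law_superuniform (eta : Omega -> R) (pval : Omega -> R) (u : R) :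
  measurable_fun setT eta -> (0 <= u)%R ->
  (forall w, (pval w)%:E = kernel_tail kap eta (T w, w)) ->
  mu ([set w | (pval w <= u)%R] `&` C) <= u%:E * mu C.
Proof.
move=> meta u0 pvalE; pose H := [set z | kernel_tail kap eta z <= u%:E].
have mH : measurable H by exact: measurable_kernel_tail_le.
have HE : [set w | (pval w <= u)%R] = [set w | H (T w, w)].
  by apply/seteqP; split => w; rewrite /H /= -pvalE lee_fin.
rewrite HE cond_law_disintegration// /joint_law -integral_cst//.
apply: ge0_le_integral => //; first exact: measurable_section.
move=> w _; rewrite (_ : xsection H (T w) =
    [set w' | kap (T w) [set w'' | (eta w' <= eta w'')%R] <= u%:E]).
  exact: tail_superuniform.
by apply/seteqP; split => w'; rewrite /xsection/= inE.
Qed.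

End disintegration.

(** * Gaussian vectors with nonzero mean *)

Section gaussian_mean.
Context {R : realType}.
Variables (n : nat) (s : R).
Hypothesis s_neq0 : s != 0.

Lemma gaussian_vector_translate (d : measure_display) (Omega : measurableType d)
    (P : probability Omega R) (eps : Omega -> 'cV[R]_n) (mu0 m : 'cV[R]_n) :
  gaussian_vector P eps mu0 s ->
  gaussian_vector P (fun w => m + eps w) (m + mu0) s.
Proof.
move=> [meps epsE]; split; first by apply: measurable_addmx => //; exact: measurable_cst.
move=> A mA; have mA' i : measurable ((fun x => x + m i 0) @^-1` A i).
  by rewrite -[X in measurable X]setTI; apply: measurable_funD.
have := epsE _ mA'.
have -> : [set w | forall i, ((fun x => x + m i 0) @^-1` A i) (eps w i 0)] =
    [set w | forall i, A i ((m + eps w) i 0)].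
  by apply/seteqP; split => w /= H i; have := H i; rewrite mxE addrC.
move=> ->; apply: eq_bigr => i _.
by rewrite normal_prob_shift// mxE addrC.
Qed.

Lemma gaussian_center (mu : probability 'cV[R]_n R) (m : 'cV[R]_n) :
  gaussian_vector mu id m s ->
  exists mu0 : probability 'cV[R]_n R,
    (forall A : 'I_n -> set R, (forall i, measurable (A i)) ->
       mu0 (rectangle A) = (\prod_(i < n) normal_prob 0 s (A i))%E) /\
    (forall E, mu E = mu0 ((fun e => m + e) @^-1` E)).
Proof.
move=> muE.
have [mf muA] := gaussian_vector_translate (- m) muE.
pose f : {mfun 'cV[R]_n >-> 'cV[R]_n} :=
  HB.pack (fun y : 'cV[R]_n => - m + y) (isMeasurableFun.Build _ _ _ _ _ mf).
exists (distribution mu f); split => [A mA|E].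
  rewrite -[LHS]/(mu [set w | forall i, A i ((- m + w) i 0)]) muA//.
  by apply: eq_bigr => i _; rewrite addNr mxE.
rewrite -[RHS]/(mu (f @^-1` _)); congr (mu _).
by apply/seteqP; split => y /=; rewrite addNKr.
Qed.

Lemma gaussian_hyperplane_null (mu : probability 'cV[R]_n R) (m a : 'cV[R]_n) (c : R) :
  gaussian_vector mu id m s -> a != 0 -> mu [set y | dotp a y = c] = 0%E.
Proof.
move=> /gaussian_center[mu0 [mu0_rect muE]] a0.
rewrite muE -[RHS](gaussian_hyperplane0 s_neq0 mu0_rect (c - dotp a m) a0).
congr (mu0 _); apply/seteqP; split => e /=; rewrite dotpDr.
  by move=> <-; rewrite addrAC subrr add0r.
by move=> ->; rewrite addrC subrK.
Qed.

(** The hypothesis on E says that it depends on y - Q y only. As Q m = 0, centring preserves both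
    this and the event on Q y, and the centred case applies. *)
Lemma gaussian_mean_indep (mu : probability 'cV[R]_n R) (m : 'cV[R]_n)
    (Q : 'M[R]_n) (E D : set 'cV[R]_n) :
  gaussian_vector mu id m s -> Q^T = Q -> Q *m Q = Q -> Q *m m = 0 ->
  measurable E -> measurable D -> (forall y, E (y - Q *m y) <-> E y) ->
  mu (E `&` mulmx Q @^-1` D) = (mu E * mu (mulmx Q @^-1` D))%E.
Proof.
move=> /gaussian_center[mu0 [mu0_rect muE]] Qs Qi Qm mE mD EQ.
pose E' := (fun e => m + e) @^-1` E.
have mE' : measurable E'.
  rewrite -[X in measurable X]setTI.
  by apply: (measurable_addmx (f := cst m) (g := id)) => //; exact: measurable_cst.
have := gaussian_proj_indep s_neq0 mu0_rect Qs Qi mE' mD.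
have -> : (fun x => x - Q *m x) @^-1` E' = E'.
  apply/seteqP; split => x; rewrite /E' /=.
    by move=> H; apply/EQ; rewrite mulmxDr Qm add0r -addrA.
  by move=> /EQ; rewrite mulmxDr Qm add0r -addrA.
have DE : mulmx Q @^-1` D = (fun e => m + e) @^-1` (mulmx Q @^-1` D).
  by apply/seteqP; split => x /=; rewrite mulmxDr Qm add0r.
by rewrite !muE preimage_setI -DE.
Qed.

End gaussian_mean.

(** * Validity of the carving p-value on a selection event *)

Section carving.
Context {R : realType}.
Variables (n p : nat) (X : 'M[R]_(n, p)) (I : {set 'I_n}) (lam s : R).
Hypotheses (lam_gt0 : 0 < lam) (s_neq0 : s != 0).
Variable bhat : 'cV[R]_n -> 'cV[R]_p.
Hypothesis bhat_lasso : forall y, is_lasso (rows_in I X) (rows_in I y) lam (bhat y).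

(** The factor c, equal to 1 or -1, turns both one-sided p-values into upper tails. *)
Lemma carving_kernel (S : {set 'I_p}) (xi : 'cV[R]_#|S|) (j : 'I_p)
    (jS : j \in S) (pval : 'cV[R]_n -> R) :
  is_carving_pvalue X s I lam xi jS pval ->
  let k := enum_rank_in jS j in
  exists (kap : R.-pker 'cV[R]_#|(S :\ j)%SET| ~> 'cV[R]_n) (c : R),
    (forall (mu : probability 'cV[R]_n R) (bS : 'cV[R]_#|S|),
       gaussian_vector mu id (cols_in S X *m bS) s -> bS k 0 = 0 ->
       cond_law mu (mulmx (cols_in (S :\ j)%SET X)^T)
                (active_constraints X I lam xi) kap) /\
    forall y, (pval y)%:E =
      kernel_tail kap (fun y => c * (lsq_pinv (cols_in S X) *m y) k 0)
                  (mulmx (cols_in (S :\ j)%SET X)^T y, y).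
Proof.
move=> [kap [kapE pvalE]] k; exists kap, (if 0 < xi k 0 then 1 else -1).
split=> // y; rewrite pvalE /kernel_tail/= -/k; congr (kap _ _).
by case: ifP => _; apply/seteqP; split => y' /=; rewrite ?mul1r// !mulN1r lerN2.
Qed.

Lemma measurable_carving_le (S : {set 'I_p}) (xi : 'cV[R]_#|S|) (j : 'I_p)
    (jS : j \in S) (pval : 'cV[R]_n -> R) (u : R) :
  is_carving_pvalue X s I lam xi jS pval -> measurable [set y | pval y <= u].
Proof.
move=> /carving_kernel[kap [c [_ pvalE]]].
apply: measurable_pvalue_le pvalE; last exact: (measurable_mulmx _ (@measurable_id _ _ setT)).
apply: measurable_funM => //; apply: (measurableT_comp (measurable_mx_entry _ _)).
exact: (measurable_mulmx _ (@measurable_id _ _ setT)).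
Qed.

Variables (b0 beta : 'cV[R]_p) (mu : probability 'cV[R]_n R).
Hypothesis b0_sg : forall j, Num.sg (b0 j 0) = b0 j 0.
Local Notation S := (active_set b0).
Local Notation xi := (sign_vector b0).
Hypothesis mu_gauss : gaussian_vector mu id (X *m beta) s.
Hypothesis beta_S : active_set beta \subset S.

Hypothesis G_unit :
  (cols_in S (rows_in I X))^T *m cols_in S (rows_in I X) \in unitmx.

(** A coefficient of the fit is an affine function of y; its linear part is a row of a matrix with a
    right inverse, hence nonzero, so its zero set is a hyperplane. *)
Lemma lasso_fit_null k : mu [set y | lasso_fit X I lam xi y k 0 = 0] = 0%E.
Proof.
pose M := invmx ((cols_in S (rows_in I X))^T *m cols_in S (rows_in I X)) *m
  (cols_in S (rows_in I X))^T *m rows_in I 1%:M.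
pose c := (invmx ((cols_in S (rows_in I X))^T *m cols_in S (rows_in I X)) *m (lam *: xi)) k 0.
have fE y : lasso_fit X I lam xi y k 0 = dotp (row k M)^T y - c.
  have -> : dotp (row k M)^T y = (M *m y) k 0 by rewrite /dotp trmxK -row_mul mxE.
  by rewrite /lasso_fit mulmxBr [LHS]mxE [X in _ + X = _]mxE (rows_inE I y) /M /c -!mulmxA.
have M_inv : M *m ((rows_in I 1%:M)^T *m cols_in S (rows_in I X)) = 1%:M.
  by rewrite /M -!mulmxA (mulmxA (rows_in I 1%:M)) rows_in1_mul_tr mul1mx mulVmx.
have Mk0 : (row k M)^T != 0.
  apply/eqP => /(congr1 trmx); rewrite trmxK trmx0 => Mk.
  have := congr1 (row k) M_inv; rewrite row_mul Mk mul0mx => /rowP/(_ k)/eqP.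
  by rewrite !mxE eqxx eq_sym oner_eq0.
rewrite -[RHS](gaussian_hyperplane_null s_neq0 c mu_gauss Mk0).
congr (mu _); apply/seteqP; split => y /=; rewrite fE => /eqP.
  by rewrite subr_eq0 => /eqP.
by rewrite -subr_eq0 => /eqP.
Qed.

Let mC : measurable (active_constraints X I lam xi).
Proof. by rewrite active_constraintsE; exact: (measurable_sign_constraints _ _ _ _).2. Qed.

Let mD : measurable (inactive_constraints X I lam xi).
Proof. exact: measurable_inactive. Qed.

Let msel : measurable (selection_event bhat b0).
Proof. exact: (measurable_selection_event lam_gt0 bhat_lasso b0_sg). Qed.

(** A Y <= b is weak whereas selection requires nonzero coefficients; the difference lies in
    finitely many null hyperplanes. *)
Lemma selection_event_measure :
  mu (active_constraints X I lam xi `&` inactive_constraints X I lam xi) =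
  mu (selection_event bhat b0).
Proof.
pose N := \big[setU/set0]_k [set y | lasso_fit X I lam xi y k 0 = 0].
have mN k : measurable [set y | lasso_fit X I lam xi y k 0 = 0].
  have mf := measurableT_comp (measurable_mx_entry k 0) (measurable_lasso_fit X I lam xi).
  by have := mf measurableT [set 0] (measurable_set1 _); rewrite setTI.
have [mNN N0] : measurable N /\ mu N = 0%E.
  apply: (big_ind (fun A => measurable A /\ mu A = 0%E)) => [|A1 A2 [mA1 A10] [mA2 A20]|k _].
  - by rewrite measure0.
  - by split; [exact: measurableU|rewrite measureU0].
  - by rewrite lasso_fit_null.
have selE := selection_eventE lam_gt0 bhat_lasso b0_sg G_unit.
rewrite -[RHS](measureU0 msel mNN N0).
apply/eqP; rewrite eq_le; apply/andP; split; last first.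
  rewrite measureU0//; apply: le_measure; rewrite ?inE//; first exact: measurableI.
  rewrite selE active_constraintsE => y [H Dy]; split => // k.
  exact/ltW/H.
apply: le_measure; rewrite ?inE; [exact: measurableI|exact: measurableU|].
rewrite selE active_constraintsE => y [H Dy].
have [Ny|nNy] := pselect (N y); [by right|left; split => // k].
rewrite lt0r H andbT mulf_neq0//.
  rewrite mxE sgr_eq0; have := enum_valP k; by rewrite inE.
apply/eqP => fk; apply: nNy; by rewrite /N (bigD1 k)//=; left.
Qed.

Let Q := lasso_proj X I S.

Lemma tr_cols_in_sub_proj (S' : {set 'I_p}) (y : 'cV[R]_n) : S' \subset S ->
  (cols_in S' X)^T *m (y - Q *m y) = (cols_in S' X)^T *m y.
Proof.
move=> S'S; suff XQ : (cols_in S' X)^T *m (Q *m y) = 0 by rewrite mulmxBr XQ subr0.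
have : (cols_in S X)^T *m (Q *m y) = 0.
  by rewrite mulmxA tr_cols_in_lasso_proj// mul0mx.
rewrite !tr_cols_in_mul => XSQ; apply/colP => k; rewrite [LHS]mxE [RHS]mxE.
have kS : enum_val k \in S by apply: (fintype.subsetP S'S); exact: enum_valP.
pose r := enum_rank_in kS (enum_val k).
apply: etrans (etrans (congr1 (fun M : 'cV_#|S| => M r 0) XSQ) _).
  by rewrite [RHS]mxE enum_rankK_in.
by rewrite mxE.
Qed.

(** By screening, the mean is X_S times a coefficient vector with zero j-th entry, so [mu] belongs
    to the selected model. Independence splits off the inactive constraints, superuniformity bounds
    the factor left, and the same independence reassembles the selection event. *)
Lemma carving_superuniform (j : 'I_p) (jS : j \in S) (pval : 'cV[R]_n -> R) (u : R) :
  is_carving_pvalue X s I lam xi jS pval -> beta j 0 = 0 -> 0 <= u ->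
  (mu ([set y | (pval y <= u)%R] `&` selection_event bhat b0) <=
   u%:E * mu (selection_event bhat b0))%E.
Proof.
move=> carv betaj u0.
have mp : measurable [set y | pval y <= u] by exact: measurable_carving_le carv.
have [kap [c [kapE pvalE]]] := carving_kernel carv.
have mean_eq : X *m beta = cols_in S X *m restrict_cv S beta by rewrite cols_in_mul_restrict.
have kap_law : cond_law mu (mulmx (cols_in (S :\ j)%SET X)^T)
    (active_constraints X I lam xi) kap.
  apply: (kapE mu (restrict_cv S beta)); first by rewrite -mean_eq.
  by rewrite mxE enum_rankK_in.
pose T := mulmx (cols_in (S :\ j)%SET X)^T : 'cV[R]_n -> _.
pose eta (y : 'cV[R]_n) := c * (lsq_pinv (cols_in S X) *m y) (enum_rank_in jS j) 0.
have mT : measurable_fun setT T by exact: (measurable_mulmx _ (@measurable_id _ _ setT)).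
have meta : measurable_fun setT eta.
  apply: measurable_funM => //; apply: (measurableT_comp (measurable_mx_entry _ _)).
  exact: (measurable_mulmx _ (@measurable_id _ _ setT)).
have sup := cond_law_superuniform mT mC kap_law meta u0 pvalE.
have pQ y : pval (y - Q *m y) = pval y.
  apply: EFin_inj; rewrite !pvalE /kernel_tail/= tr_cols_in_sub_proj ?subD1set//.
  by rewrite /lsq_pinv -!(mulmxA _ (cols_in S X)^T) tr_cols_in_sub_proj.
pose E := [set y | pval y <= u] `&` active_constraints X I lam xi.
have mE : measurable E by exact: measurableI.
have EQ y : E (y - Q *m y) <-> E y.
  rewrite /E active_constraintsE /= pQ.
  by split=> -[? H]; split => // k; have := H k; rewrite lasso_fit_sub_proj.
have Qs : Q^T = Q by exact: lasso_proj_sym.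
have Qi : Q *m Q = Q by exact: lasso_proj_idem.
have Qm : Q *m (X *m beta) = 0 by rewrite mean_eq lasso_proj_cols_in.
have indep A : measurable A -> (forall y, A (y - Q *m y) <-> A y) ->
    mu (A `&` inactive_constraints X I lam xi) =
    (mu A * mu (inactive_constraints X I lam xi))%E.
  move=> mA AQ; rewrite -(inactive_constraints_proj lam G_unit).
  exact: (gaussian_mean_indep s_neq0 mu_gauss).
apply: (@le_trans _ _ (mu (E `&` inactive_constraints X I lam xi))).
  apply: le_measure; rewrite ?inE; [exact: measurableI|exact: measurableI|].
  rewrite (selection_eventE lam_gt0 bhat_lasso b0_sg G_unit) => y [py [Hy Dy]].
  split=> //; split=> //; rewrite active_constraintsE => k; exact/ltW/Hy.
rewrite -selection_event_measure !indep//; last first.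
  by move=> y; rewrite active_constraintsE /=; split=> H k; have := H k; rewrite lasso_fit_sub_proj.
by rewrite muleA; apply: lee_wpmul2r.
Qed.

End carving.

(** * Empirical quantiles as counts *)

Section empirical_quantile.
Context {R : realType}.
Variables (B : nat) (gamma : R).
Hypotheses (B_gt0 : (0 < B)%N) (gamma01 : 0 < gamma <= 1).

(** The infimum is attained because the count is a right-continuous step function of the
    threshold. *)
Lemma emp_quantile_le (x : 'I_B -> R) (a : R) :
  (emp_quantile gamma x <= a) = (gamma * B%:R <= #|[pred b | x b <= a]|%:R).
Proof.
have /andP[g0 g1] := gamma01.
have gB0 : 0 < gamma * B%:R by rewrite mulr_gt0// ltr0n.
set A := [set t : R | #|[pred b | x b <= t]|%:R >= gamma * B%:R].
have count_le t t' : (forall b, x b <= t -> x b <= t') ->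
    (#|[pred b | x b <= t]|%:R : R) <= #|[pred b | x b <= t']|%:R.
  by move=> tt'; rewrite ler_nat; apply/subset_leq_card/fintype.subsetP => b; exact: tt'.
have xle b : `|x b| <= \sum_i `|x i|.
  by rewrite (bigD1 b)//= lerDl sumr_ge0.
have A0 : A !=set0.
  exists (\sum_i `|x i|); rewrite /A /= [X in _ <= X%:R](_ : _ = B) ?ler_piMl//.
  by rewrite -[RHS]card_ord; apply: eq_card => b; rewrite !inE (le_trans (ler_norm _)).
have Alb : lbound A (- \sum_i `|x i|).
  move=> t /= tA; have : (0 < #|[pred b | (x b <= t)%R]|)%N.
    by rewrite -(ltr_nat R) (lt_le_trans gB0).
  case/card_gt0P => b; rewrite inE; apply: le_trans.
  by have := xle b; rewrite ler_norml => /andP[].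
have hA : has_inf A by split=> //; exists (- \sum_i `|x i|).
apply/idP/idP => [infa|Aa]; last by apply: ge_inf => //; exists (- \sum_i `|x i|).
(* No sample point lies strictly between a and a + delta, so a threshold in that range counts the
   same points as a. *)
pose delta := \big[Order.min/1]_(b | a < x b) (x b - a).
have delta0 : 0 < delta by apply: lt_bigmin => // b; rewrite subr_gt0.
have : inf A < a + delta by rewrite (le_lt_trans infa)// ltrDl.
move=> /(inf_lt A0)[t At ta]; apply: le_trans At _; apply: count_le => b xt.
rewrite leNgt; apply/negP => ab.
have : delta <= x b - a by exact: (bigmin_inf b).
by lra.
Qed.

Lemma aggregate_le (x : 'I_B -> R) (a : R) :
  (aggregate gamma x <= a) =
  (1 <= a) || (gamma * B%:R <= #|[pred b | x b <= gamma * a]|%:R).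
Proof.
have /andP[g0 _] := gamma01.
rewrite /aggregate ge_min emp_quantile_le; congr (_ || (_ <= _%:R)).
by apply: eq_card => b; rewrite !inE ler_pdivrMr// mulrC.
Qed.

End empirical_quantile.

(** * Union and Markov bounds by integrating indicators *)

Section weighted_sums.
Context {R : realType} {d : measure_display} {T : measurableType d}.
Variables (mu : {measure set T -> \bar R}) (I : finType).
Variables (c : I -> R) (A : I -> set T).
Hypotheses (c_ge0 : forall i, 0 <= c i) (mA : forall i, measurable (A i)).
Local Open Scope ereal_scope.

Let mind i : measurable_fun setT (fun x => (c i * \1_(A i) x)%:E).
Proof. by apply/measurable_EFinP; apply: measurable_funM. Qed.

Let ind0 i x : 0 <= (c i * \1_(A i) x)%:E.
Proof. by rewrite lee_fin mulr_ge0// indicE. Qed.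

Let msum : measurable_fun setT (fun x => \sum_i (c i * \1_(A i) x)%:E).
Proof. exact: emeasurable_sum. Qed.

Lemma integral_weighted_sum :
  \int[mu]_x (\sum_i (c i * \1_(A i) x)%:E) = \sum_i (c i)%:E * mu (A i).
Proof.
rewrite ge0_integral_sum//; apply: eq_bigr => i _.
under eq_integral do rewrite EFinM.
rewrite ge0_integralZl//; last 2 first.
- exact/measurable_EFinP.
- by rewrite lee_fin.
by rewrite integral_indic// setIT.
Qed.

Lemma measure_le_weighted_sum (E : set T) : measurable E ->
  (forall x, E x -> (1 <= \sum_i c i * \1_(A i) x)%R) ->
  mu E <= \sum_i (c i)%:E * mu (A i).
Proof.
move=> mE EA; rewrite -integral_weighted_sum -[E in mu E]setIT -integral_indic//.
apply: ge0_le_integral => //.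
  exact/measurable_EFinP.
move=> x _; rewrite sumEFin lee_fin indicE.
case: (boolP (x \in E)) => [/set_mem/EA//|_].
by apply: sumr_ge0 => i _; rewrite -lee_fin.
Qed.

Lemma weighted_sum_le_measure (E : set T) : measurable E ->
  (forall x, (\sum_i c i * \1_(A i) x <= \1_E x)%R) ->
  \sum_i (c i)%:E * mu (A i) <= mu E.
Proof.
move=> mE EA; rewrite -integral_weighted_sum -[E in mu E]setIT -integral_indic//.
apply: ge0_le_integral => //.
- by move=> x _; exact: sume_ge0.
- exact/measurable_EFinP.
by move=> x _; rewrite sumEFin lee_fin.
Qed.

End weighted_sums.

Lemma limn_esup_le_lim (R : realType) (u v : (\bar R)^nat) (l : \bar R) :
  (forall n, u n <= v n)%E -> v @ \oo --> l -> (limn_esup u <= l)%E.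
Proof.
move=> uv /cvg_esups vl; rewrite limn_esup_lim -(cvg_lim _ vl)//.
apply: lee_lim; [exact: is_cvg_esups|exact: is_cvg_esups|apply: nearW => n].
apply: ge_ereal_sup => _ [k /= nk <-]; apply: le_trans (uv k) _.
by apply: ereal_sup_ubound; exists k.
Qed.

(** * A finite encoding of sign vectors *)

Section sign_patterns.
Context {R : realType}.
Variable p : nat.

(** The values 0, 1, 2 stand for the signs -1, 0, 1; a finite type makes the partition by signs a
    finite one. *)
Definition sign_pattern (b : 'cV[R]_p) : {ffun 'I_p -> 'I_3} :=
  [ffun j => if b j 0 < 0 then inord 0 else if b j 0 == 0 then inord 1 else inord 2].

Definition pattern_sign (t : {ffun 'I_p -> 'I_3}) : 'cV[R]_p :=
  \col_j ((t j : nat)%:R - 1).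

Lemma sign_patternK b j : pattern_sign (sign_pattern b) j 0 = Num.sg (b j 0).
Proof.
rewrite mxE ffunE; have [b0|b0|<-] := ltgtP 0 (b j 0).
- by rewrite inordK// gtr0_sg//; lra.
- by rewrite inordK// ltr0_sg// sub0r.
- by rewrite inordK// sgr0 subrr.
Qed.

Lemma sg_pattern_sign t j : Num.sg (pattern_sign t j 0) = pattern_sign t j 0.
Proof.
rewrite mxE; case: (t j) => -[|[|[|//]]] /= _.
- by rewrite sub0r sgrN sgr1.
- by rewrite subrr sgr0.
- by rewrite (_ : 2%:R - 1 = 1 :> R) ?sgr1//; lra.
Qed.

Lemma sign_pattern_eq b t :
  sign_pattern b = t <-> forall j, Num.sg (b j 0) = pattern_sign t j 0.
Proof.
split=> [<- j|H]; first by rewrite sign_patternK.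
apply/ffunP => j; have := H j; rewrite -sign_patternK !mxE.
by move=> /addIr/eqP; rewrite eqr_nat => /eqP/val_inj.
Qed.

(** The type of [sign_vector b] depends on the active set of b; quantifying over F transports
    statements along equal signs without casts. *)
Lemma sign_vector_ext (A : Type) (F : forall S : {set 'I_p}, 'cV[R]_#|S| -> A)
    (b b' : 'cV[R]_p) :
  (forall j, Num.sg (b j 0) = Num.sg (b' j 0)) ->
  F (active_set b) (sign_vector b) = F (active_set b') (sign_vector b').
Proof.
move=> bb'; pose g (c : 'cV[R]_p) : 'cV[R]_p := \col_j Num.sg (c j 0).
have gE c : sign_vector c = restrict_cv (active_set c) (g c).
  by apply/colP => k; rewrite !mxE.
have -> : F (active_set b) (sign_vector b) = F (active_set b) (restrict_cv (active_set b) (g b)).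
  by rewrite gE.
rewrite gE; have -> : g b = g b' by apply/colP => j; rewrite !mxE.
have -> // : active_set b = active_set b'.
by apply/setP => j; rewrite !inE -sgr_eq0 bb' sgr_eq0.
Qed.

End sign_patterns.

(** * Expected number of false rejections in one split *)

Section one_split.
Context {R : realType}.
Variables (n p : nat) (X : 'M[R]_(n, p)) (I : {set 'I_n}) (lam s : R).
Hypotheses (lam_gt0 : 0 < lam) (s_neq0 : s != 0).
Variable bhat : 'cV[R]_n -> 'cV[R]_p.
Hypothesis bhat_lasso : forall y, is_lasso (rows_in I X) (rows_in I y) lam (bhat y).
Variable pval : forall S : {set 'I_p}, 'cV[R]_#|S| -> 'I_p -> 'cV[R]_n -> R.
Hypothesis pval_carving : forall (S : {set 'I_p}) (xi : 'cV[R]_#|S|) (j : 'I_p)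
  (jS : j \in S), is_carving_pvalue X s I lam xi jS (pval xi j).

Definition adjusted_pval (y : 'cV[R]_n) (j : 'I_p) : R :=
  bonferroni (active_set (bhat y))
    (fun i => pval (sign_vector (bhat y)) i y) j.

Local Notation psign := (@pattern_sign R p).
Local Notation sel t := (selection_event bhat (psign t)).

Lemma selection_event_pattern t y : sel t y <-> sign_pattern (bhat y) = t.
Proof. by rewrite sign_pattern_eq. Qed.

Lemma measurable_sel t : measurable (sel t).
Proof. exact: (measurable_selection_event lam_gt0 bhat_lasso (@sg_pattern_sign R _ t)). Qed.

Lemma adjusted_pval_sel t y j : sel t y -> adjusted_pval y j =
  bonferroni (active_set (psign t))
    (fun i => pval (sign_vector (psign t)) i y) j.
Proof.
move=> ty; apply: (sign_vector_ext (fun S xi => bonferroni S (fun i => pval xi i y) j)).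
by move=> i; rewrite ty sg_pattern_sign.
Qed.

Lemma active_set_sel t y : sel t y -> active_set (bhat y) = active_set (psign t).
Proof. by move=> ty; apply/setP => j; rewrite !inE -sgr_eq0 ty. Qed.

Lemma measurable_by_pattern (E : {ffun 'I_p -> 'I_3} -> set 'cV[R]_n) (A : set 'cV[R]_n) :
  (forall t, measurable (E t)) -> (forall t y, sel t y -> (A y <-> E t y)) ->
  measurable A.
Proof.
move=> mE AE; have -> : A = \bigcup_(t in [set: {ffun 'I_p -> 'I_3}]) (sel t `&` E t).
  apply/seteqP; split => y.
    move=> Ay; exists (sign_pattern (bhat y)) => //.
    have sy : sel (sign_pattern (bhat y)) y by apply/selection_event_pattern.
    by split => //; apply/(AE _ _ sy).
  by move=> [t _ [sy]] /(AE _ _ sy).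
apply: fin_bigcup_measurable => [|t _]; first exact: finite_finset.
by apply: measurableI => //; exact: measurable_sel.
Qed.

Lemma measurable_screening (S0 : {set 'I_p}) :
  measurable [set y | S0 \subset active_set (bhat y)].
Proof.
apply: (measurable_by_pattern
  (E := fun t => if S0 \subset active_set (psign t) then setT else set0)).
  by move=> t; case: ifP.
by move=> t y /active_set_sel /= ->; case: ifP.
Qed.

Lemma measurable_adjusted_pval_le j c : measurable [set y | adjusted_pval y j <= c].
Proof.
apply: (measurable_by_pattern (E := fun t =>
  [set y | bonferroni (active_set (psign t))
    (fun i => pval (sign_vector (psign t)) i y) j <= c])).
  move=> t; rewrite /bonferroni; have [jS|jS] := boolP (j \in active_set _); last first.
    by have [c1|c1] := boolP (1 <= c); [rewrite (_ : mkset _ = setT)|rewrite (_ : mkset _ = set0)] => //; apply/seteqP; split.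
  have [c1|c1] := boolP (1 <= c).
    by rewrite (_ : mkset _ = setT)//; apply/seteqP; split => y //=; rewrite ge_min c1 orbT.
  have S0 : 0 < #|active_set (psign t)|%:R :> R.
    by rewrite ltr0n; apply/card_gt0P; exists j.
  rewrite (_ : mkset _ = [set y | pval (sign_vector (psign t)) j y <=
      c / #|active_set (psign t)|%:R]).
    exact: measurable_carving_le (pval_carving _ jS).
  by apply/seteqP; split => y /=; rewrite ge_min (negbTE c1) orbF ler_pdivlMr.
by move=> t y ty; rewrite /= (adjusted_pval_sel _ ty).
Qed.

Variables (beta : 'cV[R]_p) (mu : probability 'cV[R]_n R).
Hypothesis mu_gauss : gaussian_vector mu id (X *m beta) s.
Local Notation S0 := (active_set beta).

(** Screening is part of the event because superuniformity is available only for cells whose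
    selected set contains the true one. *)
Definition false_rejection (v : R) (j : 'I_p) : set 'cV[R]_n :=
  [set y | [/\ j \notin S0, S0 \subset active_set (bhat y) & adjusted_pval y j <= v]].

Lemma measurable_false_rejection v j : measurable (false_rejection v j).
Proof.
rewrite (_ : false_rejection v j = if j \notin S0 then
  [set y | S0 \subset active_set (bhat y)] `&` [set y | adjusted_pval y j <= v] else set0).
  case: ifP => _ //; apply: measurableI; first exact: measurable_screening.
  exact: measurable_adjusted_pval_le.
apply/seteqP; split => y; rewrite /false_rejection/=.
  by move=> [-> ? ?].
by case: ifP => // ? [? ?].
Qed.

(** As v < 1, neither the truncation at 1 nor the default 1 outside S can cause a rejection. What
    remains is p_j <= v / |S|, covered by [carving_superuniform]. *)
Lemma false_rejection_sel v j t : 0 <= v < 1 ->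
  (mu (false_rejection v j `&` sel t) <=
   (if j \in active_set (psign t)
    then v / #|active_set (psign t)|%:R else 0)%:E * mu (sel t))%E.
Proof.
move=> /andP[v0 v1]; set S := active_set _.
have mF : measurable (false_rejection v j `&` sel t).
  by apply: measurableI; [exact: measurable_false_rejection|exact: measurable_sel].
have [[jS0 S0S jS]|notall] := pselect [/\ j \notin S0, S0 \subset S & j \in S]; last first.
  rewrite (_ : _ `&` _ = set0).
    rewrite measure0 mule_ge0// lee_fin; case: ifP => // _.
    by rewrite divr_ge0.
  apply/seteqP; split => y // [[jS0 S0b pv] ty]; apply: notall; split => //.
    by rewrite /S -(active_set_sel ty).
  move: pv; rewrite (adjusted_pval_sel _ ty) /bonferroni; case: ifP => // _.
  by rewrite leNgt v1.
have [[y0 y0t]|nosel] := pselect (sel t !=set0); last first.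
  rewrite (_ : _ `&` _ = set0) ?measure0 ?mule_ge0 ?lee_fin//.
    by case: ifP => // _; rewrite divr_ge0.
  by apply/seteqP; split => y // [_ ty]; apply: nosel; exists y.
have Gu := selection_gram_unitmx lam_gt0 bhat_lasso y0t.
have cS : 0 < #|S|%:R :> R by rewrite ltr0n; apply/card_gt0P; exists j.
rewrite jS; have b0 : beta j 0 = 0 by move: jS0; rewrite inE negbK => /eqP.
apply: le_trans (carving_superuniform lam_gt0 s_neq0 bhat_lasso (@sg_pattern_sign R _ t)
   mu_gauss S0S Gu (pval_carving (sign_vector (psign t)) jS) b0 _); last first.
  by rewrite divr_ge0.
apply: le_measure; rewrite ?inE//.
  apply: measurableI; last exact: measurable_sel.
  exact: measurable_carving_le (pval_carving _ jS).
move=> y [[_ _ pv] ty]; split => //=.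
move: pv; rewrite (adjusted_pval_sel _ ty) /bonferroni -/S jS ge_min ler_pdivlMr//.
by case/orP => //; rewrite leNgt v1.
Qed.

(** In a cell the weights v / |S| over j in S add up to v, or to 0 if S is empty, and the cells
    partition the space. *)
Lemma false_rejection_sum v : 0 <= v < 1 ->
  (\sum_j mu (false_rejection v j) <= v%:E)%E.
Proof.
move=> v01; have /andP[v0 v1] := v01.
have selT y : \sum_t \1_(sel t) y = 1 :> R.
  rewrite (bigD1 (sign_pattern (bhat y)))//= big1 ?addr0 => [|t tn].
    by rewrite indicE mem_set//; apply/selection_event_pattern.
  rewrite indicE memNset// => /selection_event_pattern E.
  by rewrite E eqxx in tn.
have step j : (mu (false_rejection v j) <= \sum_t (if j \in active_set (psign t)
    then v / #|active_set (psign t)|%:R else 0)%:E * mu (sel t))%E.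
  apply: (@le_trans _ _ (\sum_t 1%:E * mu (false_rejection v j `&` sel t))%E).
    apply: measure_le_weighted_sum => // [t||y Fy].
    - by apply: measurableI; [exact: measurable_false_rejection|exact: measurable_sel].
    - exact: measurable_false_rejection.
    rewrite -[leLHS](selT y); apply: ler_sum => t _; rewrite mul1r !indicE in_setI.
    by rewrite (mem_set Fy).
  by apply: lee_sum => t _; rewrite mul1e; exact: false_rejection_sel.
apply: (le_trans (lee_sum _ (fun j _ => step j))).
rewrite exchange_big/=.
apply: (@le_trans _ _ (\sum_t v%:E * mu (sel t))%E).
  apply: lee_sum => t _; rewrite -ge0_sume_distrl => [|j _]; last first.
    by rewrite lee_fin; case: ifP => // _; rewrite divr_ge0.
  apply: lee_wpmul2r => //; rewrite sumEFin lee_fin -big_mkcond/= sumr_const.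
  set k := #|active_set _|.
  have [->|k0] := eqVneq k 0%N; first by rewrite mulr0n.
  by rewrite -[leLHS]mulr_natr divfK// pnatr_eq0.
rewrite -ge0_sume_distrr => [|t _]; last exact: measure_ge0.
rewrite -[leRHS]mule1; apply: lee_wpmul2l; first by rewrite lee_fin.
rewrite -(probability_setT mu).
under eq_bigr do rewrite -[mu _]mul1e.
apply: weighted_sum_le_measure => // [t|y]; first exact: measurable_sel.
rewrite [leRHS](_ : _ = \sum_t \1_(sel t) y); last by rewrite selT indicT.
by apply: ler_sum => t _; rewrite mul1r.
Qed.

End one_split.

(** * Aggregation over the splits *)

Section multi_split.
Context {R : realType}.
Variables (n p B : nat) (X : 'M[R]_(n, p)) (s : R) (I1 : 'I_B -> {set 'I_n}).
Variables (lam : 'I_B -> R) (bhat : 'I_B -> 'cV[R]_n -> 'cV[R]_p).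
Hypotheses (s_neq0 : s != 0) (B_gt0 : (0 < B)%N) (lam_gt0 : forall b, 0 < lam b).
Hypothesis bhat_lasso : forall b y,
  is_lasso (rows_in (I1 b) X) (rows_in (I1 b) y) (lam b) (bhat b y).
Variable pval : 'I_B -> forall S : {set 'I_p}, 'cV[R]_#|S| -> 'I_p -> 'cV[R]_n -> R.
Hypothesis pval_carving : forall b (S : {set 'I_p}) (xi : 'cV[R]_#|S|) (j : 'I_p)
  (jS : j \in S), is_carving_pvalue X s (I1 b) (lam b) xi jS (pval b xi j).
Variables (beta : 'cV[R]_p) (mu : probability 'cV[R]_n R).
Hypothesis mu_gauss : gaussian_vector mu id (X *m beta) s.
Variables (alpha gamma : R).
Hypotheses (alpha01 : 0 < alpha <= 1) (gamma01 : 0 < gamma <= 1).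
Local Notation S0 := (active_set beta).
Local Notation padj b := (adjusted_pval (bhat b) (pval b)).

Definition screening_event b : set 'cV[R]_n :=
  [set y | S0 \subset active_set (bhat b y)].

Definition familywise_error : set 'cV[R]_n :=
  [set y | exists2 j, j \notin S0 & aggregate gamma (fun b => padj b y j) <= alpha].

Let mscreen b : measurable (screening_event b).
Proof. exact: (measurable_screening (lam_gt0 b) (@bhat_lasso b)). Qed.

Let mpadj b j c : measurable [set y | padj b y j <= c].
Proof.
exact: (measurable_adjusted_pval_le (lam_gt0 b) (@bhat_lasso b) (@pval_carving b)).
Qed.

Let countE j y c : (#|[pred b | padj b y j <= c]|%:R : R) =
  \sum_b \1_[set y | padj b y j <= c] y.
Proof.
rewrite -sum1_card natr_sum big_mkcond/=; apply: eq_bigr => b _.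
rewrite indicE; have [h|h] := boolP (padj b y j <= c).
  by rewrite mem_set// inE h.
by rewrite memNset//= ?inE ?(negbTE h)//; apply/negP.
Qed.

Lemma measurable_familywise_error : measurable familywise_error.
Proof.
rewrite (_ : familywise_error = \bigcup_(j in [set j | j \notin S0])
    [set y | aggregate gamma (fun b => padj b y j) <= alpha]); last first.
  by apply/seteqP; split => y [j jS0 H]; exists j.
apply: fin_bigcup_measurable => [|j _]; first exact: finite_finset.
have [a1|a1] := boolP (1 <= alpha).
  rewrite (_ : mkset _ = setT)//; apply/seteqP; split => y //= _.
  by rewrite aggregate_le// a1.
rewrite (_ : mkset _ = (fun y => \sum_b \1_[set y | padj b y j <= gamma * alpha] y)
    @^-1` `[gamma * B%:R, +oo[).
  rewrite -[X in measurable X]setTI; apply: measurable_sum => // b.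
  exact/measurable_indicP.
apply/seteqP; split => y /=; rewrite aggregate_le// (negbTE a1)/= in_itv/= andbT.
  by rewrite -countE.
by rewrite -countE.
Qed.

(** If every split screens, an error forces at least gamma B pairs (b, j) with a false rejection at
    level gamma alpha, whose expected number is at most B gamma alpha. Markov's inequality leaves
    alpha. *)
Lemma familywise_error_le :
  (mu familywise_error <= alpha%:E + \sum_b (1 - mu (screening_event b)))%E.
Proof.
have /andP[a0 a1] := alpha01; have /andP[g0 g1] := gamma01.
have miss_ge0 b : (0 <= 1 - mu (screening_event b))%E.
  by rewrite sube_ge0 ?probability_le1// fin_num_measure.
(* At alpha = 1 the bound is trivial; otherwise gamma alpha < 1, as [false_rejection_sum]
   requires. *)
have [a_ge1|a_lt1] := lerP 1 alpha.
  apply: (@le_trans _ _ 1%E); first exact: probability_le1 measurable_familywise_error.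
  by rewrite -[leLHS]adde0; apply: leeD; [rewrite lee_fin|exact: sume_ge0].
pose v := gamma * alpha.
have v01 : 0 <= v < 1.
  by rewrite mulr_ge0 ?ltW//= (le_lt_trans _ a_lt1)// ler_piMl// ltW.
have gB0 : 0 < gamma * B%:R by rewrite mulr_gt0// ltr0n.
pose F b := false_rejection (bhat b) (pval b) beta v.
have mF b j : measurable (F b j).
  exact: (measurable_false_rejection (lam_gt0 b) (@bhat_lasso b) (@pval_carving b)).
(* One weighted sum handles both terms: false rejections with the Markov weight 1 / (gamma B),
   failures of screening with weight 1. *)
pose A (i : ('I_B * 'I_p) + 'I_B) := match i with
  inl bj => F bj.1 bj.2 | inr b => ~` screening_event b end.
pose c (i : ('I_B * 'I_p) + 'I_B) : R := match i with
  inl _ => (gamma * B%:R)^-1 | inr _ => 1 end.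
have c0 i : 0 <= c i by case: i => //= _; rewrite invr_ge0 ltW.
have mA i : measurable (A i).
  by case: i => [bj|b] /=; [exact: mF|apply: measurableC; exact: mscreen].
apply: (@le_trans _ _ (\sum_i (c i)%:E * mu (A i))%E).
  apply: measure_le_weighted_sum => //; first exact: measurable_familywise_error.
  move=> y [j jS0 Qj]; rewrite big_sumType/=.
  have ind0 (D : set 'cV[R]_n) : 0 <= \1_D y :> R by rewrite indicE.
  have [[b missb]|hit] := pselect (exists b, ~ screening_event b y).
    rewrite -[leLHS]add0r; apply: lerD.
      by apply: sumr_ge0 => i _; rewrite mulr_ge0// invr_ge0 ltW.
    rewrite (bigD1 b)//= mul1r indicE mem_set// lerDl.
    by apply: sumr_ge0 => i _; rewrite mul1r.
  rewrite -[leLHS]addr0; apply: lerD; last by apply: sumr_ge0 => i _; rewrite mul1r.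
  rewrite -mulr_sumr mulrC ler_pdivlMr// mul1r.
  move: Qj; rewrite aggregate_le// leNgt a_lt1/= countE => /le_trans; apply.
  rewrite -(pair_bigA _ (fun b j => \1_(F b j) y))/=; apply: ler_sum => b _.
  apply: (@le_trans _ _ (\1_(F b j) y)); last first.
    by rewrite (bigD1 j)//= lerDl sumr_ge0.
  rewrite !indicE ler_nat; case: (boolP (y \in [set y | _])) => // /set_mem/= yv.
  rewrite mem_set//; split => //; apply: contrapT => nscr; apply: hit.
  by exists b.
rewrite big_sumType/=; apply: leeD; last first.
  apply: lee_sum => b _; rewrite mul1e probability_setC//; exact: mscreen.
rewrite -ge0_sume_distrr => [|i _]; last exact: measure_ge0.
rewrite -(pair_bigA _ (fun b j => mu (F b j)))/=.
apply: (@le_trans _ _ ((gamma * B%:R)^-1%:E * \sum_(b < B) v%:E)%E).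
  apply: lee_wpmul2l; first by rewrite lee_fin invr_ge0 ltW.
  apply: lee_sum => b _.
  exact: (false_rejection_sum (lam_gt0 b) s_neq0 (@bhat_lasso b) (@pval_carving b) mu_gauss v01).
rewrite sumEFin sumr_const card_ord -EFinM lee_fin /v -mulr_natr.
rewrite le_eqVlt; apply/orP; left; apply/eqP.
have BR0 : B%:R != 0 :> R by rewrite pnatr_eq0 -lt0n.
by field; rewrite BR0 gt_eqF.
Qed.

End multi_split.

(** * The asymptotic statement *)

Theorem theorem1 (R : realType)
  (* the Gaussian linear model, for each sample size n *)
  (sigma : R) (sigma_gt0 : 0 < sigma)
  (p : nat -> nat)
  (X : forall n, 'M[R]_(n, p n)) (beta : forall n, 'cV[R]_(p n))
  (d : nat -> measure_display) (Omega : forall n, measurableType (d n))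
  (P : forall n, probability (Omega n) R)
  (eps Y : forall n, Omega n -> 'cV[R]_n)
  (eps_gauss : forall n, gaussian_vector (P n) (@eps n) 0 sigma)
  (Y_model : forall n w, Y n w = X n *m beta n + eps n w)
  (* the B splits: I1 n b is the selection group of split b *)
  (B : nat) (B_gt0 : (0 < B)%N)
  (n1 : nat -> nat) (I1 : forall n, 'I_B -> {set 'I_n})
  (card_I1 : forall n b, #|I1 n b| = n1 n)
  (* the Lasso estimates, as functions of the data *)
  (lam : nat -> 'I_B -> R) (lam_gt0 : forall n b, 0 < lam n b)
  (bhat : forall n, 'I_B -> 'cV[R]_n -> 'cV[R]_(p n))
  (bhat_lasso : forall n b (y : 'cV[R]_n),
     is_lasso (rows_in (I1 n b) (X n)) (rows_in (I1 n b) y) (lam n b)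
              (bhat n b y))
  (* the carving p-values for given selected set and signs *)
  (pval : forall n, 'I_B -> forall S : {set 'I_(p n)},
     'cV[R]_#|S| -> 'I_(p n) -> 'cV[R]_n -> R)
  (pval_carving : forall n b (S : {set 'I_(p n)}) (xi : 'cV[R]_#|S|)
     (j : 'I_(p n)) (jS : j \in S),
     is_carving_pvalue (X n) sigma (I1 n b) (lam n b) xi jS
                       (pval n b S xi j))
  (* (i) asymptotic screening *)
  (screening : forall b,
     P n [set w | active_set (beta n) \subset active_set (bhat n b (Y n w))]
       @[n --> \oo] --> 1%E)
  (* (ii) sparsity *)
  (sparsity : forall n b, (0 < n)%N -> \forall w \ae P n,
     let Shat := active_set (bhat n b (Y n w)) in
     (#|Shat| < n1 n)%N /\
     \rank (cols_in Shat (rows_in (I1 n b) (X n))) = #|Shat|)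
  (alpha gamma : R) (alpha01 : 0 < alpha <= 1) (gamma01 : 0 < gamma <= 1) :
  let Padj n (b : 'I_B) (y : 'cV[R]_n) (j : 'I_(p n)) : R :=
    let bh := bhat n b y in
    bonferroni (active_set bh)
      (fun i => pval n b (active_set bh) (sign_vector bh) i y) j in
  let Q n (y : 'cV[R]_n) (j : 'I_(p n)) : R :=
    aggregate gamma (fun b => Padj n b y j) in
  (limn_esup (fun n => P n [set w |
     \big[Order.min/+oo]_(j < p n | j \notin active_set (beta n))
        (Q n (Y n w) j)%:E <= alpha%:E]) <= alpha%:E)%E.
Proof.
have s_neq0 : sigma != 0 by rewrite gt_eqF.
cbv zeta.
have Y_gauss n : gaussian_vector (P n) (@Y n) (X n *m beta n) sigma.
  have := gaussian_vector_translate s_neq0 (X n *m beta n) (@eps_gauss n).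
  by rewrite addr0; congr gaussian_vector; apply/funext => w; rewrite Y_model.
pose fY n : {mfun Omega n >-> 'cV[R]_n} :=
  HB.pack (@Y n) (isMeasurableFun.Build _ _ _ _ _ (Y_gauss n).1).
pose mu n : probability 'cV[R]_n R := distribution (P n) (fY n).
have mu_gauss n : gaussian_vector (mu n) id (X n *m beta n) sigma.
  by split; [exact: measurable_id|exact: (Y_gauss n).2].
apply: (@limn_esup_le_lim _ _ (fun n => alpha%:E + \sum_b
  (1 - P n [set w | active_set (beta n) \subset active_set (bhat n b (Y n w))]))%E).
  move=> n.
  have := familywise_error_le s_neq0 B_gt0 (lam_gt0 n) (bhat_lasso n)
    (pval_carving n) (mu_gauss n) alpha01 gamma01.
  apply: le_trans; rewrite -[leRHS]/(P n (Y n @^-1` _)).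
  (* The two events coincide: a finite minimum is at most alpha exactly when some term is, and the
     default +oo of an empty minimum is never at most alpha. *)
  rewrite le_eqVlt; apply/orP; left; apply/eqP; congr (P n _).
  apply/seteqP; split => w /=.
    rewrite leNgt => /bigmin_gtP/not_andP[|].
      by rewrite ltry.
    move=> /existsNP[j /not_implyP[jS0 Qj]]; exists j => //.
    by rewrite leNgt -lte_fin; apply/negP.
  by move=> [j jS0 Qj]; apply: (bigmin_inf j) => //; rewrite lee_fin.
pose scr b n : set (Omega n) :=
  [set w | active_set (beta n) \subset active_set (bhat n b (Y n w))].
have mscr b n : measurable (scr b n).
  have := measurable_screening (lam_gt0 n b) (bhat_lasso n b) (active_set (beta n)).
  by move=> /((Y_gauss n).1 measurableT); rewrite setTI.
have : (fun n => \sum_b (1 - P n (scr b n)))%E @ \oo --> (\sum_(b < B) 0)%E.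
  apply: cvg_nnesum => b _.
    by apply: nearW => n; rewrite sube_ge0 ?probability_le1// fin_num_measure.
  by rewrite -(@subee _ 1)//; apply: cvgeB => //; [exact: cvg_cst|exact: screening].
rewrite big1// => scr0; rewrite -[X in _ --> X]adde0.
by apply: cvgeD => //; exact: cvg_cst.
Qed.
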